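(* Fix an integer $r\geq 3$. There exists a constant $C>0$ (depending only on $r$) such that for all sufficiently large $d$, \[\frac{2^d}{d\,(\log d)^{C}}\;\leq\; M_r(d)\;\leq\; \frac{2^d}{d}\,(\log d)^{C}.\] That is, $M_r(d)=\frac{2^d}{d}(\log d)^{-O(1)}$ as $d\to\infty$.
   Context: Let $Q_d=\{0,1\}^d$ be the $d$-dimensional hypercube graph, where two vertices are adjacent iff they differ in exactly one coordinate. In $r$-neighbour bootstrap percolation on $Q_d$, given an initial set $A_0\subseteq\{0,1\}^d$ of infected vertices, one sets $A_{t+1}=A_t\cup\{v\in\{0,1\}^d : v \text{ has at least } r \text{ neighbours in } A_t\}$ for $t\geq 0$. The set $A_0$ percolates if $A_t=\{0,1\}^d$ for some $t$, and its percolation time is the least such $t$. $M_r(d)$ denotes the maximum of the percolation time over all percolating sets $A_0\subseteq\{0,1\}^d$. *)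

(* Defs.v *)
From mathcomp Require Import all_boot all_order all_algebra.
From mathcomp Require Import boolp reals exp.

Set Implicit Arguments.
Unset Strict Implicit.
Unset Printing Implicit Defensive.

Definition cube (d : nat) := {ffun 'I_d -> bool}.

Definition cube_adj (d : nat) : rel (cube d) :=
  fun u v => #|[set i : 'I_d | u i != v i]| == 1.

Definition bootstrap_step (r d : nat) (A : {set cube d}) : {set cube d} :=
  A :|: [set v : cube d | r <= #|[set u in A | cube_adj v u]|].

Definition infected (r d : nat) (A0 : {set cube d}) (t : nat) : {set cube d} :=
  iter t (bootstrap_step r (d := d)) A0.

Definition percolates (r d : nat) (A0 : {set cube d}) : Prop :=
  exists t : nat, infected r A0 t == [set: cube d].

(* The value 0 for non-percolating sets is a dummy: [max_perc_time] below only *)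
(* ranges over percolating sets.                                              *)
Definition perc_time (r d : nat) (A0 : {set cube d}) : nat :=
  if pselect (percolates r A0) is left h then ex_minn h else 0.

(* The range is never empty, since the full cube percolates. *)
Definition max_perc_time (r d : nat) : nat :=
  \max_(A0 : {set cube d} | `[< percolates r A0 >]) perc_time r A0.

(* Main.v *)
Require Import Defs.
From mathcomp Require Import all_boot all_order all_algebra zify.
From mathcomp Require Import boolp reals sequences exp.

(* Upper bound. For each time [t] choose a vertex [v t] that becomes infected  *)
(* at time [t]. It has fewer than [r] neighbours infected at time [t - 2],     *)
(* while a vertex [w] with many neighbours among the [v t] is infected right   *)
(* after the first [r] of them. Double counting the pairs ([v t], [w]) gives   *)
(* [M_r(d) * d = O(2^d)].                                                      *)
(*                                                                             *)
(* Lower bound. A 3-snake is a path along which the distance of two vertices   *)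
(* at least 3 steps apart is at least 3; every vertex has at most two          *)
(* neighbours on it, so that for [r = 3] the infection can be forced to run    *)
(* along it step by step. A path [x_0, x_1, ...] of a cube [A] is lifted to a  *)
(* 3-snake of [A * C * C], where [C] contains a label [e x] for each [x] such  *)
(* that labels of vertices at distance 1 or 2 are far apart: over [x_k] one    *)
(* register (given by the parity of [x_k]) rests at [e x_k] while the other    *)
(* travels from [e x_(k-1)] to [e x_(k+1)] along a 3-snake of [C], flagged as  *)
(* invalid meanwhile. With the syndromes of a Hamming code as labels, [C] has  *)
(* dimension [log a + O(log log a)]. Lifting once with geodesics in [C] loses  *)
(* a polynomial factor; lifting again, with paths of the first kind in [C],    *)
(* only loses a factor [a * polylog a]. Finally inert seeds, set off by the    *)
(* end of the snake, make the whole cube percolate.                            *)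

Set Implicit Arguments.
Unset Strict Implicit.
Unset Printing Implicit Defensive.

(** * Cubes *)

Definition cflip d (k : 'I_d) (x : cube d) : cube d := [ffun i => (i == k) (+) x i].

Definition hamming d (x y : cube d) : nat := \sum_(i < d) (x i != y i).

Lemma cflipK d (k : 'I_d) : involutive (cflip k).
Proof. by move=> x; apply/ffunP=> i; rewrite !ffunE addbA addbb. Qed.

Lemma hammingC d (x y : cube d) : hamming x y = hamming y x.
Proof. by apply: eq_bigr => i _; rewrite eq_sym. Qed.

Lemma hamming_triangle d (y x z : cube d) : hamming x z <= hamming x y + hamming y z.
Proof.
rewrite /hamming -big_split /=; apply: leq_sum => i _.
by case: (x i); case: (y i); case: (z i).
Qed.

Lemma hamming_eq0 d (x y : cube d) : (hamming x y == 0) = (x == y).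
Proof.
apply/idP/eqP => [|->]; last by rewrite /hamming big1 // => i _; rewrite eqxx.
rewrite sum_nat_eq0 => /forallP h; apply/ffunP => i.
by have := h i; case: (x i); case: (y i).
Qed.

Lemma hamming_cflip d (k : 'I_d) (x y : cube d) :
  hamming (cflip k x) y + (x k != y k) = hamming x y + (x k == y k).
Proof.
rewrite /hamming (bigD1 k) //= [in RHS](bigD1 k) //= ffunE eqxx /=.
have -> : \sum_(i < d | i != k) (cflip k x i != y i) = \sum_(i < d | i != k) (x i != y i).
  by apply: eq_bigr => i /negbTE ik; rewrite ffunE ik.
have -> : (~~ x k != y k) = (x k == y k) by case: (x k); case: (y k).
by case: (x k == y k); rewrite /= ?addn0 ?add0n addnC.
Qed.

Lemma hamming_cflip_id d (k : 'I_d) (x : cube d) : hamming x (cflip k x) = 1.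
Proof.
have := hamming_cflip k x x; rewrite eqxx /= addn0 hammingC => ->.
by have /eqP-> : hamming x x == 0 by rewrite hamming_eq0.
Qed.

Lemma hamming_neq d (x y : cube d) : x != y -> exists2 k, x k != y k &
  hamming x y = (hamming (cflip k x) y).+1.
Proof.
move=> xy; suff [k hk] : exists k, x k != y k.
  exists k => //; have := hamming_cflip k x y.
  by rewrite hk (negbTE hk) addn0 addn1.
apply/existsP; apply: contra_neqT xy; rewrite negb_exists => /forallP h.
by apply/ffunP => i; apply/eqP; rewrite -[_ == _]negbK.
Qed.

Lemma hamming1P d (x y : cube d) : hamming x y = 1 -> exists k, y = cflip k x.
Proof.
move=> h; have [] := @hamming_neq _ x y.
  by rewrite -hamming_eq0 h.
move=> k _; rewrite h => -[] /esym/eqP; rewrite hamming_eq0 => /eqP <-; by exists k.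
Qed.

Definition cparity d (x : cube d) : bool := odd (\sum_(i < d) x i).

Lemma cparity_hamming d (x y : cube d) : odd (hamming x y) = cparity x (+) cparity y.
Proof.
rewrite /cparity /hamming -oddD -big_split /=.
elim/big_rec2: _ => // i a b _ h; rewrite !oddD h.
by case: (x i); case: (y i); case: (odd a).
Qed.

(* A type together with an isometry onto a cube; products of such types        *)
(* replace the concatenation of coordinate blocks.                             *)
Record hcube := HCube {
  hsort :> Type;
  hdim : nat;
  hiso : hsort -> cube hdim;
  hinv : cube hdim -> hsort;
  hisoK : cancel hiso hinv;
  hinvK : cancel hinv hiso }.
Arguments hiso {h}.
Arguments hinv {h}.

Canonical cubeH (d : nat) : hcube :=
  @HCube (cube d) d id id (fun=> erefl) (fun=> erefl).

Section BoolH.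
Definition bool_iso (b : bool) : cube 1 := [ffun=> b].
Definition bool_inv (x : cube 1) : bool := x ord0.
Fact bool_isoK : cancel bool_iso bool_inv.
Proof. by move=> b; rewrite /bool_inv ffunE. Qed.
Fact bool_invK : cancel bool_inv bool_iso.
Proof. by move=> x; apply/ffunP => i; rewrite ffunE /bool_inv (ord1 i). Qed.
Canonical boolH : hcube := HCube bool_isoK bool_invK.
End BoolH.

Section ProdH.
Variables A B : hcube.
Definition prod_iso (p : A * B) : cube (hdim A + hdim B) :=
  [ffun k => match split k with inl i => hiso p.1 i | inr j => hiso p.2 j end].
Definition prod_inv (x : cube (hdim A + hdim B)) : A * B :=
  (hinv [ffun i => x (lshift _ i)], hinv [ffun j => x (rshift _ j)]).
Lemma prod_iso_lshift p i : prod_iso p (lshift _ i) = hiso p.1 i.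
Proof. by rewrite ffunE (unsplitK (inl i)). Qed.
Lemma prod_iso_rshift p i : prod_iso p (rshift _ i) = hiso p.2 i.
Proof. by rewrite ffunE (unsplitK (inr i)). Qed.
Fact prod_isoK : cancel prod_iso prod_inv.
Proof.
move=> [a b]; rewrite /prod_inv; congr (_, _); rewrite -[RHS]hisoK; congr hinv;
  by apply/ffunP => i; rewrite ffunE (prod_iso_lshift, prod_iso_rshift).
Qed.
Fact prod_invK : cancel prod_inv prod_iso.
Proof.
move=> x; apply/ffunP => k; rewrite -(splitK k).
by case: (split k) => i /=; rewrite (prod_iso_lshift, prod_iso_rshift) /= hinvK ffunE.
Qed.
Canonical prodH : hcube := HCube prod_isoK prod_invK.
End ProdH.

Definition dist (T : hcube) (x y : T) : nat := hamming (hiso x) (hiso y).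
Definition hflip (T : hcube) (k : 'I_(hdim T)) (x : T) : T := hinv (cflip k (hiso x)).
Definition hzero (T : hcube) : T := hinv [ffun=> false].

Section DistTheory.
Variable T : hcube.
Implicit Types x y z : T.

Lemma hiso_inj : injective (@hiso T). Proof. exact: can_inj (@hisoK T). Qed.

Lemma distC x y : dist x y = dist y x. Proof. exact: hammingC. Qed.

Lemma dist_triangle y x z : dist x z <= dist x y + dist y z.
Proof. exact: hamming_triangle. Qed.

Lemma dist_eq0 x y : dist x y = 0 -> x = y.
Proof. by move/eqP; rewrite hamming_eq0 => /eqP/hiso_inj. Qed.

Lemma distxx x : dist x x = 0.
Proof. by apply/eqP; rewrite hamming_eq0. Qed.

Lemma dist_gt0 x y : x <> y -> 0 < dist x y.
Proof. by move=> h; rewrite lt0n; apply/eqP => /dist_eq0. Qed.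

Lemma dist_step x y : x <> y -> exists2 x', dist x x' = 1 & dist x y = (dist x' y).+1.
Proof.
move=> xy; have /hamming_neq[k _ h] : hiso x != hiso y by apply/eqP => /hiso_inj.
by exists (hflip k x); rewrite /dist /hflip hinvK // hamming_cflip_id.
Qed.

Lemma dist_hflip x (k : 'I_(hdim T)) : dist x (hflip k x) = 1.
Proof. by rewrite /dist hinvK hamming_cflip_id. Qed.

Lemma dist1P x y : dist x y = 1 -> exists k, y = hflip k x.
Proof. by move/hamming1P => [k h]; exists k; rewrite /hflip -h hisoK. Qed.

Lemma hflip_inj x : injective (fun k => hflip k x).
Proof.
move=> k l /(can_inj (@hinvK T))/ffunP/(_ k); rewrite !ffunE eqxx.
by case: eqP => // _; case: (hiso x k).
Qed.

End DistTheory.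

Lemma dist_prod (A B : hcube) (a a' : A) (b b' : B) :
  dist (a, b) (a', b') = dist a a' + dist b b'.
Proof.
rewrite /dist /hamming /= big_split_ord /=; congr (_ + _); apply: eq_bigr => i _;
  by rewrite !(prod_iso_lshift, prod_iso_rshift).
Qed.

Lemma dist_bool (b b' : bool) : dist b b' = (b != b').
Proof. by rewrite /dist /hamming big_ord_recl big_ord0 addn0 /= !ffunE. Qed.

Lemma dist_cube d (x y : cube d) : dist x y = hamming x y.
Proof. by []. Qed.

Lemma isometry_of_dim (T : hcube) (n : nat) : hdim T = n ->
  exists f : T -> cube n, exists2 g : cube n -> T, cancel f g /\ cancel g f &
    forall x y, dist (f x) (f y) = dist x y.
Proof.
case: n /; exists hiso; exists hinv => //; split; [exact: hisoK | exact: hinvK].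
Qed.

(** * Snakes *)

Notation "s ~[ i ]" := (nth (hzero _) s i) (at level 1, format "s ~[ i ]").

Definition snake (T : hcube) (k : nat) (s : seq T) : Prop :=
  (forall i, i.+1 < size s -> dist s~[i] s~[i.+1] = 1) /\
  (forall i j, i < j -> j < size s -> minn k (j - i) <= dist s~[i] s~[j]).

Definition links (T : hcube) (s : seq T) (u v : T) : Prop :=
  [/\ 0 < size s, s~[0] = u & s~[(size s).-1] = v].

Section Snake.
Variable T : hcube.
Implicit Types (s : seq T) (u v w : T).

Lemma snake1 k u : snake k [:: u].
Proof. by split=> [[]|[|i] [|j]] //=. Qed.

Lemma links1 u : links [:: u] u u. Proof. by []. Qed.

Lemma links_cat s1 s2 u v w w' : links s1 u w -> links s2 w' v -> links (s1 ++ s2) u v.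
Proof.
move=> [p1 h1 l1] [p2 h2 l2]; split; first by rewrite size_cat; lia.
  by rewrite nth_cat p1.
rewrite nth_cat size_cat; have -> : (size s1 + size s2).-1 < size s1 = false by lia.
by rewrite -l2; congr nth; lia.
Qed.

Lemma snake_cat k s1 s2 u v w w' : links s1 u w -> links s2 w' v -> dist w w' = 1 ->
  snake k s1 -> snake k s2 ->
  (forall i j, i < size s1 -> j < size s2 ->
     minn k (size s1 - i + j) <= dist s1~[i] s2~[j]) ->
  snake k (s1 ++ s2).
Proof.
move=> [p1 _ l1] [p2 h2 _] ww [a1 f1] [a2 f2] cr; split=> [i|i j ij]; rewrite size_cat !nth_cat => hi.
  case: (ltnP i.+1 (size s1)) => h1.
    by rewrite (ltnW h1); apply: a1.
  case: (ltnP i (size s1)) => h3; last by rewrite subSn //; apply: a2; lia.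
  have -> : i.+1 - size s1 = 0 by lia.
  have -> : i = (size s1).-1 by lia.
  by rewrite h2 l1.
case: (ltnP j (size s1)) => h1; first by rewrite (ltn_trans ij h1); exact: f1.
case: (ltnP i (size s1)) => h3.
  apply: leq_trans (cr _ _ h3 _); last by lia.
  have -> : size s1 - i + (j - size s1) = j - i by lia.
  exact: leqnn.
apply: leq_trans (f2 _ _ _ _); lia.
Qed.

Lemma snake_cons k s u v w : links s v w -> dist u v = 1 -> snake k s ->
  (forall j, j < size s -> minn k j.+1 <= dist u s~[j]) ->
  snake k (u :: s) /\ links (u :: s) u w.
Proof.
move=> ls uv ss cr; split; last exact: links_cat (links1 u) ls.
apply: (@snake_cat k [:: u] s _ _ _ _ (links1 u) ls uv (snake1 k u) ss).
by move=> [|i] // j _ /cr h; rewrite subn0 add1n.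
Qed.

Lemma snake_geodesic k u v : exists2 s, links s u v & snake k s.
Proof.
pose ok u s := links s u v /\ snake k s /\
  forall j, j < size s -> j <= dist u s~[j] /\ dist u s~[j] + dist s~[j] v = dist u v.
suff H : forall m u, dist u v < m -> exists s, ok u s.
  by have [s [h1 [h2 _]]] := H _ u (ltnSn _); exists s.
move=> {u}; elim=> // m IH u hu.
case: (pselect (u = v)) => [->|/dist_step[u' uu' e]].
  exists [:: v]; split=> //; split; first exact: snake1.
  by move=> [|j] // _; rewrite /= distxx.
have [|s [h1 [h2 h3]]] := IH u'; first by lia.
have D j : j < size s -> dist u s~[j] = (dist u' s~[j]).+1.
  move=> /h3[_ h]; have := dist_triangle s~[j] u v; have := dist_triangle u' u s~[j].
  by rewrite uu'; lia.
have [|h4 h5] := snake_cons h1 uu' h2.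
  by move=> j hj; rewrite D //; have [] := h3 j hj; lia.
exists (u :: s); split=> //; split=> // -[|j] /= hj; first by rewrite distxx.
by have := D j hj; have [] := h3 j hj; lia.
Qed.

End Snake.

Lemma snake_map (T U : hcube) (f : T -> U) k (s : seq T) u v :
  (forall x y, dist (f x) (f y) = dist x y) ->
  snake k s -> links s u v -> snake k (map f s) /\ links (map f s) (f u) (f v).
Proof.
move=> fi [h1 h2] [p h0 hl].
have E i : i < size s -> (map f s)~[i] = f s~[i] by move=> hi; rewrite (nth_map (hzero T)).
split; last by split; rewrite ?size_map // E ?h0 ?hl //; lia.
split=> [i|i j ij]; rewrite size_map => hi.
  by rewrite !E ?fi ?h1 //; lia.
by rewrite !E ?fi ?h2 //; lia.
Qed.

Lemma long_path_exists (b : nat) (u v : cube b) : u <> v ->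
  exists s : seq (cube b), [/\ links s u v, snake 1 s & 2 ^ b < (size s).*2].
Proof.
elim: b u v => [|b IH] u v.
  by case; apply/ffunP; case.
suff H : forall u v : prodH (cubeH b) boolH, u <> v ->
  exists s : seq (prodH (cubeH b) boolH), [/\ links s u v, snake 1 s & 2 ^ b.+1 < (size s).*2].
  have [|f [g [fg gf] fi]] := @isometry_of_dim (prodH (cubeH b) boolH) b.+1.
    by rewrite /= addn1.
  move=> uv; have [|s [l h e]] := H (g u) (g v); first by move/(can_inj gf).
  have [h' l'] := snake_map fi h l.
  by exists (map f s); rewrite !gf in l'; split=> //; rewrite size_map.
have IHm al x y : x <> y -> exists s : seq (prodH (cubeH b) boolH),
   [/\ links s (x, al) (y, al), snake 1 s, 2 ^ b < (size s).*2
     & forall i, i < size s -> s~[i].2 = al].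
  move=> /IH[s [l h e]].
  have fi x1 y1 : @dist (prodH (cubeH b) boolH) (x1, al) (y1, al) = @dist (cubeH b) x1 y1.
    by rewrite dist_prod distxx addn0.
  have [h' l'] := @snake_map (cubeH b) (prodH (cubeH b) boolH) (fun x => (x, al)) 1 s x y fi h l.
  exists (map (fun x => (x, al)) s); split=> //; first by rewrite size_map.
  by move=> i; rewrite size_map => hi; rewrite (nth_map (hzero (cubeH b))).
have opp (p q : prodH (cubeH b) boolH) : p.2 != q.2 -> 0 < dist p q.
  by case: p q => [x c] [y d] /= h; rewrite dist_prod dist_bool h addn1.
have cross (x : cube b) (al : bool) : dist ((x, al) : prodH (cubeH b) boolH) (x, ~~ al) = 1.
  by rewrite dist_prod dist_bool distxx; case: al.
rewrite expnS mul2n.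
move=> [u' al] [v' be] uv.
have [ab|/eqP ab] := eqVneq al be.
  have u'v' : u' <> v' by move=> e; apply: uv; rewrite e ab.
  have [s1 [l1 h1 e1 a1]] := IHm al _ _ u'v'.
  case: s1 l1 h1 e1 a1 => [[]//|x [|y t]] l1 h1 e1 a1.
    by case: l1 => _ /= xu xv; case: u'v'; move: xv; rewrite xu => -[].
  have xu : x = (u', al) by case: l1.
  have := a1 1 erefl; rewrite /=; case: y l1 h1 e1 a1 => y c l1 h1 e1 a1 /= cE; subst c x.
  have adj := (proj1 h1) 0 erefl; rewrite /= in adj.
  have u'y : u' <> y by move=> e; move: adj; rewrite e distxx.
  have [s2 [l2 h2 e2 a2]] := IHm (~~ al) _ _ u'y.
  have hT : snake 1 ((y, al) :: t).
    split=> [i hi|i j ij hi]; first by have := (proj1 h1) i.+1; apply.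
    by have := (proj2 h1) i.+1 j.+1; rewrite subSS; apply.
  have lT : links ((y, al) :: t) (y, al) (v', be).
    by case: l1 => _ _ /= h; split=> //; rewrite -ab.
  have hs : snake 1 (s2 ++ (y, al) :: t).
    apply: snake_cat l2 lT _ h2 hT _; first by rewrite -{2}[al]negbK cross.
    move=> i j hi hj; apply: leq_trans (geq_minl _ _) _; apply: opp.
    by rewrite a2 // (a1 j.+1) //; case: (al).
  have ls := links_cat l2 lT.
  have [|h l] := snake_cons ls (cross _ _) hs.
    move=> j hj; apply: leq_trans (geq_minl _ _) _; rewrite nth_cat.
    case: (ltnP j) => hj2; first by apply: (opp (u', al)); rewrite a2 //=; case: (al).
    have := (proj2 h1) 0 (j - size s2).+1 erefl; rewrite /= => H.
    apply: leq_trans (H _); first by lia.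
    by rewrite size_cat /= in hj; lia.
  exists ((u', al) :: s2 ++ (y, al) :: t); split=> //.
  by move: e1 e2; rewrite /= size_cat /= !doubleS doubleD doubleS; lia.
have be_al : be = ~~ al by case: (al) (be) ab => [] [].
subst be => {ab uv}.
have glue w s1 s2 : links s1 (u', al) (w, al) -> snake 1 s1 ->
   (forall i, i < size s1 -> s1~[i].2 = al) ->
   links s2 (w, ~~ al) (v', ~~ al) -> snake 1 s2 ->
   (forall i, i < size s2 -> s2~[i].2 = ~~ al) ->
   links (s1 ++ s2) (u', al) (v', ~~ al) /\ snake 1 (s1 ++ s2).
  move=> l1 h1 a1 l2 h2 a2; split; first exact: links_cat l1 l2.
  apply: snake_cat l1 l2 (cross _ _) h1 h2 _.
  move=> i j hi hj; apply: leq_trans (geq_minl _ _) _; apply: opp.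
  by rewrite a1 // a2 //; case: (al).
have single x c : links [:: (x, c) : prodH (cubeH b) boolH] (x, c) (x, c) /\
    snake 1 [:: (x, c) : prodH (cubeH b) boolH] /\
    (forall i, i < 1 -> [:: (x, c) : prodH (cubeH b) boolH]~[i].2 = c).
  by split=> //; split; [exact: snake1 | case].
case: (pselect (exists w, u' <> w /\ w <> v')) => [[w [uw wv]]|none].
  have [s1 [l1 h1 e1 a1]] := IHm al _ _ uw.
  have [s2 [l2 h2 e2 a2]] := IHm (~~ al) _ _ wv.
  have [l h] := glue _ _ _ l1 h1 a1 l2 h2 a2.
  by exists (s1 ++ s2); split=> //; rewrite size_cat doubleD; lia.
have bs : 2 ^ b <= #|[set u'; v']|.
  have -> : 2 ^ b = #|[set: cube b]| by rewrite cardsT card_ffun card_bool card_ord.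
  apply/subset_leq_card/subsetP => w _; rewrite !inE.
  by apply/norP => -[/eqP h1 /eqP h2]; apply: none; exists w; split=> //; exact/nesym.
have [l2 [h2 a2]] := single v' (~~ al).
rewrite cards2 in bs; case: eqP bs => [uv bs|uv bs] /=.
  have [l1 [h1 a1]] := single u' al; rewrite uv in l1 *.
  rewrite uv in glue h1 a1; have [l h] := glue _ _ _ l1 h1 a1 l2 h2 a2.
  by eexists; split; [exact: l | exact: h|]; rewrite /= in bs *; lia.
have [s1 [l1 h1 e1 a1]] := IHm al _ _ uv.
have [l h] := glue _ _ _ l1 h1 a1 l2 h2 a2.
eexists; split; [exact: l | exact: h|]; rewrite size_cat /= in bs *.
by move: bs e1; move: (2 ^ b) (size s1) => M N; rewrite -!mul2n; lia.
Qed.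

(** * Lifting paths to snakes *)

Definition code3 (T U : hcube) (e : T -> U) : Prop :=
  forall x y, e x = e y \/ 3 <= dist (e x) (e y).

Definition separates2 (T U : hcube) (e : T -> U) : Prop :=
  forall x y, 1 <= dist x y <= 2 -> e x <> e y.

Definition flagH : hcube := prodH (prodH boolH boolH) boolH.
Definition flag0 : flagH := (false, false, false).
Definition flagged (B : hcube) (b : B) : prodH B flagH := (b, flag0).

(* A snake from [x] to [y] that comes near a point of the code [range e] only  *)
(* at its two ends, where it leaves (resp. approaches) it at unit speed.       *)
Definition transit (T C : hcube) (e : T -> C) (x y : T) (g : seq C) : Prop :=
  [/\ links g (e x) (e y), snake 3 g &
   forall j z, j < size g -> dist g~[j] (e z) <= 1 ->
     (e z = e x /\ dist g~[j] (e z) = j) \/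
     (e z = e y /\ dist g~[j] (e z) = (size g).-1 - j)].

Section Transit.
Variables (T B : hcube) (e : T -> B).
Hypothesis code_e : code3 e.

Definition rampup (b : B) : seq (prodH B flagH) :=
  [:: (b, (false, false, false)); (b, (true, false, false)); (b, (true, true, false))].

Definition rampdown (b : B) : seq (prodH B flagH) :=
  [:: (b, (true, true, false)); (b, (true, false, false)); (b, (false, false, false))].

Lemma transit_exists x y (s : seq B) : e x <> e y -> links s (e x) (e y) -> snake 3 s ->
  exists2 g, transit (fun z => flagged (e z)) x y g & size s <= size g.
Proof.
move=> xy ls hs; have [p s0 sl] := ls.
have dxy : 3 <= dist (e x) (e y) by case: (code_e x y).
pose f (b : B) : prodH B flagH := (b, (true, true, true)).
have fi b c : dist (f b) (f c) = dist b c by rewrite dist_prod distxx addn0.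
have [hM lM] := snake_map fi hs ls.
have dE (b c : B) (f1 f2 f3 g1 g2 g3 : bool) :
   dist (b, (f1, f2, f3) : flagH) (c, (g1, g2, g3) : flagH) =
   dist b c + ((f1 != g1) + (f2 != g2) + (f3 != g3)).
  by rewrite !dist_prod !dist_bool.
have hU b : snake 3 (rampup b).
  by split=> [[|[|i]]|[|[|[|i]]] [|[|[|j]]]] // *; rewrite /= dE distxx.
have hD b : snake 3 (rampdown b).
  by split=> [[|[|i]]|[|[|[|i]]] [|[|[|j]]]] // *; rewrite /= dE distxx.
have lU b : links (rampup b) (b, (false, false, false)) (b, (true, true, false)) by [].
have lD b : links (rampdown b) (b, (true, true, false)) (b, (false, false, false)) by [].
have ME j : j < size s -> (map f s)~[j] = f s~[j] by move=> hj; rewrite (nth_map (hzero B)).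
have d0 j : j < size s -> minn 3 j <= dist (e x) s~[j].
  case: j => [|j] hj; first by rewrite minn0.
  by have := (proj2 hs) 0 j.+1 erefl hj; rewrite s0 subn0.
have dl j : j < size s -> minn 3 ((size s).-1 - j) <= dist s~[j] (e y).
  move=> hj; case: (eqVneq j (size s).-1) => [->|nj]; first by rewrite subnn minn0.
  by have := (proj2 hs) j (size s).-1; rewrite sl; apply; lia.
have hUM : snake 3 (rampup (e x) ++ map f s).
  apply: snake_cat (lU _) lM _ (hU _) hM _; first by rewrite dE distxx.
  move=> i j hi; rewrite size_map => hj; rewrite ME //; have := d0 j hj.
  by case: i hi => [|[|[|i]]] // _; rewrite /= dE /=; lia.
have lUM := links_cat (lU (e x)) lM.
have hg : snake 3 (rampup (e x) ++ map f s ++ rampdown (e y)).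
  rewrite catA; apply: snake_cat lUM (lD _) _ hUM (hD _) _; first by rewrite dE distxx.
  move=> i j; rewrite size_cat size_map nth_cat /= => hi hj.
  case: (ltnP i 3) => hi3.
    by case: i {hi} hi3 => [|[|[|i]]] // _; case: j hj => [|[|[|j]]] // _; rewrite /= dE; lia.
  have hi' : i - 3 < size s by lia.
  rewrite ME //; have := dl _ hi'.
  by case: j hj => [|[|[|j]]] // _; rewrite /= dE /=; lia.
exists (rampup (e x) ++ map f s ++ rampdown (e y)); last by rewrite !size_cat size_map; lia.
split=> //; first by rewrite catA; exact: links_cat lUM (lD _).
move=> j z; rewrite !size_cat size_map !nth_cat /= => hj.
have near b w : dist (e w) (e z) + b <= 1 -> e z = e w /\ dist (e w) (e z) + b = b.
  case: (code_e w z) => [->|h1 h2]; last by lia.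
  by move=> _; split=> //; rewrite distxx.
case: (ltnP j 3) => j3.
  rewrite /flagged /flag0 => H; left; move: H.
  by case: j {hj} j3 => [|[|[|j]]] // _; rewrite /= dE /= => /near[-> ->].
rewrite size_map; case: (ltnP (j - 3)) => j4.
  by rewrite ME // /flagged /flag0 dE /=; lia.
have : j - 3 - size s < 3 by lia.
move=> hk; rewrite /flagged /flag0 => H; right; move: H.
have -> : (3 + (size s + 3)).-1 - j = 2 - (j - 3 - size s) by lia.
by move: hk; case: (j - 3 - size s) => [|[|[|k]]] // _; rewrite /= dE /= => /near[-> ->].
Qed.

End Transit.

Section Lift.
Variables (a : nat) (C : hcube) (e : cube a -> C) (g : cube a -> cube a -> seq C) (l : nat).
Hypothesis sep_e : @separates2 (cubeH a) C e.
Hypothesis g_ok : forall x y : cube a, 1 <= hamming x y <= 2 ->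
  @transit (cubeH a) C e x y (g x y) /\ l <= size (g x y).

Let S : hcube := prodH (prodH (cubeH a) C) C.

Definition lift_pt (x : cube a) (c : C) : S :=
  if cparity x then (x, c, e x) else (x, e x, c).

Fixpoint snake_lift (p x : cube a) (s : seq (cube a)) : seq S :=
  if s is n :: s' then map (lift_pt x) (g p n) ++ snake_lift x n s'
  else map (lift_pt x) (g p x).

Lemma dist_lift_pt_same x c c' : dist (lift_pt x c) (lift_pt x c') = dist c c'.
Proof.
by rewrite /lift_pt; case: cparity; rewrite !dist_prod !distxx ?addn0 ?add0n.
Qed.

Lemma dist_lift_pt_adj x y c c' : hamming x y = 1 ->
  dist (lift_pt x c) (lift_pt y c') = (dist c (e y) + dist (e x) c').+1.
Proof.
move=> xy; have := cparity_hamming x y; rewrite xy /lift_pt.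
by case: (cparity x); case: (cparity y) => // _; rewrite !dist_prod dist_cube xy; lia.
Qed.

Lemma dist_lift_pt_far x y c c' : 2 <= hamming x y -> 3 <= dist (lift_pt x c) (lift_pt y c').
Proof.
move=> xy; have : hamming x y <= dist (lift_pt x c) (lift_pt y c').
  by rewrite /lift_pt; case: (cparity x); case: (cparity y); rewrite !dist_prod dist_cube; lia.
case: (ltnP 2 (hamming x y)) => [|h _]; first by lia.
have {h}h : hamming x y = 2 by lia.
have := cparity_hamming x y; rewrite h /lift_pt.
have : 0 < dist (e x) (e y) by apply/dist_gt0/sep_e; rewrite dist_cube h.
by case: (cparity x); case: (cparity y) => // d0 _; rewrite !dist_prod dist_cube h; lia.
Qed.

Definition before (p x : cube a) (s : seq (cube a)) :=
  (p = x /\ s <> [::]) \/ (hamming p x = 1 /\ p \notin x :: s).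

Lemma e_inj2 x y : hamming x y <= 2 -> e x = e y -> x = y.
Proof.
move=> h exy; apply/eqP; rewrite -hamming_eq0 -leqn0 leqNgt; apply/negP => h0.
by apply: (@sep_e x y); rewrite // dist_cube h0.
Qed.

Lemma fibre_ok p x n : 1 <= hamming p n <= 2 ->
  [/\ links (map (lift_pt x) (g p n)) (lift_pt x (e p)) (lift_pt x (e n)),
      snake 3 (map (lift_pt x) (g p n)), l <= size (map (lift_pt x) (g p n)) &
      forall i, i < size (g p n) ->
        (map (lift_pt x) (g p n))~[i] = lift_pt x (g p n)~[i]].
Proof.
move=> /g_ok[[lg hg _] lz].
have [h1 h2] := snake_map (@dist_lift_pt_same x) hg lg.
by split=> //; rewrite ?size_map // => i hi; rewrite (nth_map (hzero C)).
Qed.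

Lemma snake_lift_nth x n s : path (fun u v => hamming u v == 1) x (n :: s) -> uniq (x :: n :: s) ->
  forall j, j < size (snake_lift x n s) ->
  (exists m c, [/\ m \in s & (snake_lift x n s)~[j] = lift_pt m c]) \/
  exists m, [/\ 1 <= hamming x m <= 2, j < size (g x m), e m <> e x &
             (snake_lift x n s)~[j] = lift_pt n (g x m)~[j]].
Proof.
elim: s x n => [|m s IH] x n /=.
  rewrite andbT => /eqP xn _ j; rewrite size_map => hj; right; exists n.
  have h1 : 1 <= hamming x n <= 2 by rewrite xn.
  split=> //; last by rewrite (nth_map (hzero C)).
  by move=> E; apply: (@sep_e x n) => //.
move=> /and3P[/eqP xn /eqP nm hp] /andP[xs us] j; rewrite size_cat nth_cat size_map.
have h1 : 1 <= hamming x m <= 2.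
  apply/andP; split; last by have := hamming_triangle n x m; rewrite xn nm.
  by rewrite lt0n hamming_eq0; apply: contraNneq xs => ->; rewrite !inE eqxx orbT.
case: (ltnP j (size (g x m))) => hj hj'.
  right; exists m; split=> //; last by rewrite (nth_map (hzero C)).
  by move=> E; apply: (@sep_e x m) => //.
left; have [|||[m' [c [h2 h3]]]|[m' [_ _ _ ->]]] := IH n m _ _ (j - size (g x m)).
- by rewrite /= nm eqxx.
- by [].
- by rewrite ltn_subLR.
- by exists m', c; split=> //; rewrite inE h2 orbT.
- by exists m, (g n m')~[j - size (g x m)]; rewrite inE eqxx.
Qed.

Lemma snake_lift_snake p x s : path (fun u v => hamming u v == 1) x s -> uniq (x :: s) ->
  before p x s ->
  [/\ links (snake_lift p x s) (lift_pt x (e p)) (lift_pt (last x s) (e (last x s))),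
      snake 3 (snake_lift p x s) & l * (size s).+1 <= size (snake_lift p x s)].
Proof.
elim: s p x => [|n s IH] p x.
  move=> _ _ [[]//|[px _]]; have [|h1 h2 h3 _] := @fibre_ok p x x; first by rewrite px.
  by rewrite muln1.
move=> hp hu hb; have xn : hamming x n = 1 by move: hp => /= /andP[/eqP].
have pn2 : hamming p n <= 2.
  case: hb => [[-> _]|[px _]]; first by rewrite xn.
  by have := hamming_triangle x p n; rewrite px xn.
have pnn : p != n.
  case: hb => [[-> _]|[px]]; first by rewrite -hamming_eq0 xn.
  by rewrite !inE !negb_or => /and3P[].
have pn : 1 <= hamming p n <= 2 by rewrite pn2 lt0n hamming_eq0 pnn.
have [l1 h1 z1 n1] := fibre_ok x pn.
have [|||l2 h2 z2] := IH x n _ _ _.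
- by move: hp => /= /andP[].
- by move: hu => /= /andP[].
- by right; split=> //; move: hu => /= /andP[].
have adj : dist (lift_pt x (e n)) (lift_pt n (e x)) = 1 by rewrite dist_lift_pt_adj // !distxx.
split; [exact: links_cat l1 l2| |by rewrite /= size_cat mulnS leq_add].
apply: snake_cat l1 l2 adj h1 h2 _; rewrite size_map => i j hi hj; rewrite n1 //.
have [[lg _ near] _] := g_ok pn.
case: (snake_lift_nth hp hu hj) => [[m [c [ms ->]]]|[m [hm jm emx ->]]].
  case: (ltnP 1 (hamming x m)) => xm; first by have := dist_lift_pt_far (g p n)~[i] c xm; lia.
  have xms : x != m by apply: contraTneq hu => ->; rewrite /= inE ms orbT.
  have {}xm : hamming x m = 1.
    by apply/eqP; rewrite eqn_leq xm lt0n hamming_eq0.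
  rewrite dist_lift_pt_adj //; apply: leq_trans (geq_minl _ _) _.
  case: (leqP (dist (g p n)~[i] (e m)) 1) => [hd|]; last by lia.
  exfalso; case: (near _ _ hi hd) => -[E _].
    have mp : m = p.
      apply: e_inj2 => //; case: hb => [[-> _]|[px _]]; first by rewrite hammingC xm.
      by have := hamming_triangle x m p; rewrite (hammingC m x) xm (hammingC x p) px.
    case: hb => [[px _]|[_]]; first by move: xms; rewrite mp px eqxx.
    by rewrite -mp !inE ms !orbT.
  have mn : m = n.
    by apply: e_inj2 => //; have := hamming_triangle x m n; rewrite (hammingC m x) xm xn.
  by move: hu; rewrite mn in ms; rewrite /= ms andbF.
rewrite dist_lift_pt_adj //.
case: (leqP (dist (g p n)~[i] (e n)) 1) => [hd|]; last by lia.
case: (leqP (dist (e x) (g x m)~[j]) 1) => [hd'|]; last by lia.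
have [[_ _ near'] _] := g_ok hm.
case: (near _ _ hi hd) => -[E ->].
  by case/eqP: pnn; apply: e_inj2.
rewrite distC in hd' *; case: (near' _ x jm hd') => -[E' ->]; last by case: emx.
by lia.
Qed.

End Lift.

Lemma snake_lift_exists a (C : hcube) (e : cube a -> C) l : @separates2 (cubeH a) C e ->
  (forall x y : cube a, 1 <= hamming x y <= 2 ->
     exists2 g, @transit (cubeH a) C e x y g & l <= size g) ->
  forall u v : cube a, u <> v ->
  exists s : seq (prodH (prodH (cubeH a) C) C),
    [/\ links s (u, e u, e u) (v, e v, e v), snake 3 s & l * 2 ^ a <= (size s).*2].
Proof.
move=> sep hg u v uv.
have /choice[g gE] : forall p : cube a * cube a, exists g, 1 <= hamming p.1 p.2 <= 2 ->
    @transit (cubeH a) C e p.1 p.2 g /\ l <= size g.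
  move=> [x y] /=; case: (boolP (1 <= hamming x y <= 2)) => [/hg[g h1 h2]|_].
    by exists g.
  by exists [::].
have [s [[s0 su sv] [sa su'] hs]] := long_path_exists uv.
case: s s0 su sv sa su' hs => // x s _ /= xu sv sa su' hs; subst x.
have vE : last u s = v by rewrite (last_nth u) -sv; apply: set_nth_default.
have hp : path (fun u v => hamming u v == 1) u s.
  apply/(pathP (hzero (cubeH a))) => i hi; apply/eqP; exact: (sa i hi).
have hu : uniq (u :: s).
  apply/negP => /negP/(uniqPn (hzero (cubeH a)))[i [j [ij hj E]]].
  by have := su' i j ij hj; rewrite E distxx; lia.
have hb : before u u s by left; split=> // sE; apply: uv; rewrite -vE sE.
have [h1 h2 h3] := snake_lift_snake (g := fun x y => g (x, y)) sep (fun x y h => gE (x, y) h) hp hu hb.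
exists (snake_lift e (fun x y => g (x, y)) u u s).
have ptE x : lift_pt e x (e x) = (x, e x, e x) by rewrite /lift_pt; case: cparity.
rewrite !ptE vE in h1; split=> //.
apply: leq_trans (leq_mul (leqnn l) (ltnW hs)) _; rewrite -!mul2n mulnCA.
by rewrite leq_pmul2l.
Qed.

Lemma syndrome_exists m q : m < 2 ^ q ->
  exists sg : cube m -> cube q, @separates2 (cubeH m) (cubeH q) sg.
Proof.
move=> mq; pose z : cube q := [ffun=> false].
pose cols := enum [set~ z]; pose h (i : 'I_m) : cube q := nth z cols i.
have hs : m <= size cols.
  rewrite -cardE; have := cardsC1 z; rewrite card_ffun card_bool card_ord => ->.
  by lia.
have hz i : h i != z.
  have : h i \in cols by apply: mem_nth; apply: leq_trans hs.
  by rewrite mem_enum !inE.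
have hinj i j : h i = h j -> i = j.
  move=> E; apply/val_inj/eqP; rewrite -(@nth_uniq _ z cols) ?enum_uniq //; first exact/eqP.
    exact: leq_trans (ltn_ord _) hs.
  exact: leq_trans (ltn_ord _) hs.
pose sg (x : cube m) : cube q := [ffun j => odd (\sum_(i < m) (x i && h i j))].
have sg_flip k x j : sg (cflip k x) j = sg x j (+) h k j.
  rewrite !ffunE (bigD1 k) //= [in RHS](bigD1 k) //= ffunE eqxx /= !oddD.
  have -> : \sum_(i < m | i != k) (cflip k x i && h i j) = \sum_(i < m | i != k) (x i && h i j).
    by apply: eq_bigr => i /negbTE ik; rewrite ffunE ik.
  by rewrite !oddb; case: (x k); case: (h k j); case: (odd _).
exists sg => x y; rewrite dist_cube => xy E.
have xny : x != y by rewrite -hamming_eq0 -lt0n; case/andP: xy.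
have [k _ hk] := hamming_neq xny.
case: (eqVneq (cflip k x) y) => [yE|yn].
  case/eqP: (hz k); apply/ffunP => j; have /ffunP/(_ j) := E.
  have -> : z j = false by rewrite ffunE.
  by rewrite -yE sg_flip; case: (sg x j); case: (h k j).
have /hamming1P[k' yE] : hamming (cflip k x) y = 1.
  by apply/eqP; rewrite eqn_leq [0 < _]lt0n hamming_eq0 yn andbT; case/andP: xy; rewrite hk.
have kk' : k = k'.
  apply: hinj; apply/ffunP => j; have /ffunP/(_ j) := E.
  by rewrite yE !sg_flip; case: (sg x j); case: (h k j); case: (h k' j).
by move: xny; rewrite yE -kk' cflipK eqxx.
Qed.

Definition rep3H (U : hcube) : hcube := prodH (prodH U U) U.
Definition rep3 (U : hcube) (c : U) : rep3H U := (c, c, c).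

Lemma dist_rep3 (U : hcube) (c c' : U) : dist (rep3 c) (rep3 c') = 3 * dist c c'.
Proof. by rewrite !dist_prod; lia. Qed.

Lemma code3_rep3 (T U : hcube) (e : T -> U) : code3 (fun x => rep3 (e x)).
Proof.
move=> x y; case: (pselect (e x = e y)) => [->|/dist_gt0 h]; first by left.
by right; rewrite dist_rep3; lia.
Qed.

Lemma lossy_snake_exists b q : b < 2 ^ q ->
  exists (T : hcube) (i : cube b -> T),
   [/\ hdim T = b + 2 * (3 * q + 3),
       forall u v, hamming u v <= dist (i u) (i v) &
       forall u v, u <> v -> exists s : seq T,
         [/\ links s (i u) (i v), snake 3 s & 2 ^ b <= (size s).*2]].
Proof.
move=> /syndrome_exists[sg sep].
pose e (x : cube b) := rep3 (sg x : cubeH q).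
have ce : @code3 (cubeH b) _ e by exact: (@code3_rep3 (cubeH b)).
exists (prodH (prodH (cubeH b) (prodH (rep3H (cubeH q)) flagH)) (prodH (rep3H (cubeH q)) flagH)).
exists (fun x => (x, flagged (e x), flagged (e x))); split.
- by rewrite /=; lia.
- by move=> u v; rewrite !dist_prod dist_cube; lia.
move=> u v uv.
have [||s [h1 h2 h3]] := @snake_lift_exists b (prodH (rep3H (cubeH q)) flagH)
   (fun x => flagged (e x)) 1 _ _ u v uv; last by exists s; rewrite mul1n in h3.
- by move=> x y xy [h _ _]; exact: (sep _ _ xy h).
move=> x y xy; have [s hs hs'] := snake_geodesic 3 (e x) (e y).
have [|g hg sz] := transit_exists ce _ hs hs'.
  by case=> h _ _; exact: (sep _ _ xy h).
exists g => //; apply: leq_trans sz; by case: hs.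
Qed.

Lemma long_snake_exists a s q q1 (b := s + (q + q + q)) :
  a < 2 ^ s -> s < 2 ^ q -> b < 2 ^ q1 -> 0 < a ->
  exists (T : hcube) (p : seq T),
   [/\ hdim T = a + 2 * (b + 2 * (3 * q1 + 3) + 3), snake 3 p &
       2 ^ a * 2 ^ b <= 4 * size p].
Proof.
move=> /syndrome_exists[sg sep] /syndrome_exists[tau sept] /lossy_snake_exists[B [i [dB iB lB]]] a0.
pose W := prodH (cubeH s) (rep3H (cubeH q)).
have [//|f [g [fg gf] fi]] := @isometry_of_dim W b.
pose E (x : cube a) : cube b := f (sg x, rep3 (tau (sg x) : cubeH q)).
have Einj x y : E x = E y -> sg x = sg y by move/(can_inj fg) => [].
have cE x y : E x = E y \/ 3 <= hamming (E x) (E y).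
  case: (pselect (sg x = sg y)) => [h|h]; first by left; rewrite /E h.
  right; rewrite -dist_cube fi dist_prod dist_rep3 dist_cube.
  have h0 : 0 < hamming (sg x) (sg y) by exact: (@dist_gt0 (cubeH s)).
  case: (ltnP 2 (hamming (sg x) (sg y))) => h2; first by lia.
  have : 0 < dist (tau (sg x)) (tau (sg y)).
    by apply: dist_gt0; apply: sept; rewrite dist_cube h0.
  by lia.
have ci : @code3 (cubeH a) B (fun x => i (E x)).
  by move=> x y; case: (cE x y) => [->|h]; [left | right; exact: leq_trans (iB _ _)].
have iEn x y : 1 <= hamming x y <= 2 -> E x <> E y.
  by move=> xy /Einj; exact: sep.
have iEn' x y : 1 <= hamming x y <= 2 -> i (E x) <> i (E y).
  move=> xy h; apply: (iEn x y) => //; apply/eqP; rewrite -hamming_eq0.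
  by have := iB (E x) (E y); rewrite h distxx leqn0.
have := @snake_lift_exists a (prodH B flagH) (fun x => flagged (i (E x))) ((2 ^ b).+1 ./2).
move=> /(_ _ _ [ffun=> false] [ffun=> true])[|||p [h1 h2 h3]].
- by move=> x y xy []; exact: iEn'.
- move=> x y xy; have [p [h1 h2 h3]] := lB _ _ (iEn _ _ xy).
  have [|g' hg sz] := transit_exists ci _ h1 h2; first exact: iEn'.
  by exists g' => //; apply: leq_trans sz; lia.
- by move/ffunP/(_ (Ordinal a0)); rewrite !ffunE.
exists (prodH (prodH (cubeH a) (prodH B flagH)) (prodH B flagH)), p; split=> //.
  by rewrite /= dB; lia.
have : 2 ^ b <= (2 ^ b).+1./2.*2 by lia.
move=> h4; apply: leq_trans (leq_mul (leqnn _) h4) _.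
by rewrite -!mul2n in h3 *; rewrite mulnCA [2 ^ a * _]mulnC; lia.
Qed.

(** * Bootstrap percolation on cubes *)

Definition nb (T : hcube) (W : pred T) (v : T) : nat :=
  \sum_(k < hdim T) (W (hflip k v) : nat).

Definition bstep (T : hcube) (r : nat) (W : pred T) : pred T :=
  fun v => W v || (r <= nb W v).

Definition infection (T : hcube) (r : nat) (W : pred T) (t : nat) : pred T :=
  iter t (@bstep T r) W.

Definition closed_under (T : hcube) (r : nat) (Y : pred T) : Prop :=
  forall v, r <= nb Y v -> Y v.

Definition slow_percolation (T : hcube) (r L : nat) : Prop :=
  exists2 W : pred T,
    (forall Y : pred T, closed_under r Y -> (forall v, W v -> Y v) -> forall v, Y v) &
    exists v, ~~ infection r W L v.

Definition slow_infection (T : hcube) (r L : nat) : Prop :=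
  exists (W : pred T) (x : T), ~~ infection r W L x /\
    (forall Y : pred T, closed_under r Y -> (forall v, W v -> Y v) -> Y x).

Section Neighbours.
Variable T : hcube.
Implicit Types (W : pred T) (u v : T).

Lemma nb_card W v : nb W v = #|[pred k | W (hflip k v)]|.
Proof. by rewrite /nb -sum1_card [RHS]big_mkcond; apply: eq_bigr => k _; rewrite inE; case: (W _). Qed.

Lemma nb_mono W W' v : (forall u, W u -> W' u) -> nb W v <= nb W' v.
Proof. by move=> h; apply: leq_sum => k _; have := h (hflip k v); case: (W _) => // ->. Qed.

Lemma nb_gt0P W v : 0 < nb W v -> exists2 u, W u & dist v u = 1.
Proof.
rewrite nb_card => /card_gt0P[k]; rewrite inE => h.
by exists (hflip k v); rewrite // dist_hflip.
Qed.

Lemma nb_gt0 W v u : W u -> dist v u = 1 -> 0 < nb W v.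
Proof. by move=> Wu /dist1P[k kE]; rewrite nb_card; apply/card_gt0P; exists k; rewrite inE -kE. Qed.

Lemma nb_gt1 W v u u' : W u -> W u' -> u <> u' -> dist v u = 1 -> dist v u' = 1 -> 1 < nb W v.
Proof.
move=> Wu Wu' uu' /dist1P[k kE] /dist1P[k' kE']; rewrite nb_card; apply/card_gt1P.
exists k, k'; rewrite !inE -kE -kE'; split=> //.
by apply/eqP => kk'; apply: uu'; rewrite kE kE' kk'.
Qed.

Lemma nb_gt1P W v : 1 < nb W v ->
  exists u u', [/\ W u, W u', u <> u', dist v u = 1 & dist v u' = 1].
Proof.
rewrite nb_card => /card_gt1P[k [k' []]]; rewrite !inE => h h' kk'.
exists (hflip k v), (hflip k' v); split; rewrite ?dist_hflip //.
by move/hflip_inj => E; rewrite E eqxx in kk'.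
Qed.

Lemma nb_code W v : (forall u u', W u -> W u' -> u <> u' -> 3 <= dist u u') -> nb W v <= 1.
Proof.
move=> h; rewrite leqNgt; apply/negP => /nb_gt1P[u [u' [Wu Wu' uu' d1 d2]]].
by have := dist_triangle v u u'; have := h _ _ Wu Wu' uu'; rewrite (distC u v) d1 d2; lia.
Qed.

Lemma nbU W1 W2 v : nb (fun u => W1 u || W2 u) v <= nb W1 v + nb W2 v.
Proof. by rewrite /nb -big_split; apply: leq_sum => k _; case: (W1 _); case: (W2 _). Qed.

Lemma nb_pred0 W v : (forall u, W u -> False) -> nb W v = 0.
Proof.
move=> h; apply/eqP; rewrite -leqn0 leqNgt; apply/negP => /nb_gt0P[u /h //].
Qed.

Lemma dist_odd (y x z : T) : odd (dist x z) = odd (dist x y) (+) odd (dist y z).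
Proof. by rewrite !cparity_hamming -!addbA; congr (_ (+) _); rewrite addbA addbb. Qed.

Lemma infectionS r W t v :
  infection r W t.+1 v = infection r W t v || (r <= nb (infection r W t) v).
Proof. by []. Qed.

Lemma infection_mono r W t t' v : t <= t' -> infection r W t v -> infection r W t' v.
Proof.
move=> /subnK <-; elim: (t' - t) => // n IH h.
by rewrite addSn infectionS IH.
Qed.

Lemma infection_sub r W (B : nat -> pred T) L : (forall v, W v -> B 0 v) ->
  (forall t v, t < L -> B t v -> B t.+1 v) ->
  (forall t v, t < L -> r <= nb (B t) v -> B t.+1 v) ->
  forall t v, t <= L -> infection r W t v -> B t v.
Proof.
move=> h0 hm hs; elim=> [|t IH] v tL; first exact: h0.
rewrite infectionS => /orP[h|h]; first by apply: hm => //; apply: IH => //; exact: ltnW.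
apply: hs => //; apply: leq_trans h _; apply: nb_mono => u; apply: IH; exact: ltnW.
Qed.

Lemma infection_stable r W : exists t, closed_under r (infection r W t).
Proof.
apply: contrapT => none.
pose c t := #|[set x : cube (hdim T) | infection r W t (hinv x)]|.
have cS t : c t < c t.+1.
  have [v [h1 h2]] : exists v, r <= nb (infection r W t) v /\ ~~ infection r W t v.
    apply: contrapT => h; apply: none; exists t => v hv; apply: contrapT => nv.
    by apply: h; exists v; split=> //; apply/negP.
  apply: proper_card; apply/properP; split.
    by apply/subsetP => x; rewrite !inE; exact: infection_mono.
  exists (hiso v); rewrite inE hisoK //.
  by rewrite infectionS h1 orbT.
have cl t : t <= c t by elim: t => // t IH; exact: leq_ltn_trans (cS t).
have := cl #|cube (hdim T)|.+1; rewrite leqNgt => /negP; apply.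
by rewrite ltnS; exact: max_card.
Qed.

Lemma closed_connected W u v : closed_under 1 W -> W u -> W v.
Proof.
move=> cl Wu; have [n] := ubnP (dist v u); elim: n v => // n IH v.
case: (pselect (v = u)) => [-> //|/dist_step[v' vv' ->] h].
by apply: cl; apply: (@nb_gt0 _ _ v') => //; apply: IH.
Qed.

End Neighbours.

Lemma nb_prod (A B : hcube) (W : pred (prodH A B)) (a : A) (b : B) :
  nb W (a, b) = nb (fun a' => W (a', b)) a + nb (fun b' => W (a, b')) b.
Proof.
rewrite /nb /= big_split_ord /=; congr (_ + _); apply: eq_bigr => k _; congr (nat_of_bool (W _)).
  apply: (@hiso_inj (prodH A B)); rewrite hinvK; apply/ffunP => i.
  rewrite -(splitK i) ffunE; case: (split i) => j /=.
    by rewrite !prod_iso_lshift /= hinvK ffunE (inj_eq (@lshift_inj _ _)).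
  by rewrite !prod_iso_rshift /= eq_rlshift.
apply: (@hiso_inj (prodH A B)); rewrite hinvK; apply/ffunP => i.
rewrite -(splitK i) ffunE; case: (split i) => j /=.
  by rewrite !prod_iso_lshift /= eq_lrshift.
by rewrite !prod_iso_rshift /= hinvK ffunE (inj_eq (@rshift_inj _ _)).
Qed.

Lemma nb_bool (W : pred boolH) (b : bool) : nb W b = W (~~ b).
Proof.
rewrite /nb big_ord_recl big_ord0 addn0; congr (nat_of_bool (W _)).
by rewrite /hflip /= /bool_inv !ffunE eqxx.
Qed.

Lemma slow_percolationS (T : hcube) r L :
  slow_percolation T r L -> slow_percolation (prodH T boolH) r.+1 L.
Proof.
move=> [W hW [v hv]]; pose W' : pred (prodH T boolH) := fun p => p.2 || W p.1.
exists W'.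
  move=> Y cY WY [u [|]]; first by apply: WY.
  apply: (hW (fun u => Y (u, false))) => [w hw|w Ww].
    by apply: cY; rewrite nb_prod nb_bool WY ?addn1.
  by apply: WY; rewrite /W' /= Ww.
exists (v, false); apply: contra hv.
suff H : forall t p, infection r.+1 W' t p -> p.2 || infection r W t p.1 by move/H.
elim=> [|t IH] [u b] //; rewrite infectionS => /orP[/IH|].
  by move=> /orP[/= ->//|h]; rewrite [X in _ || X](infection_mono (leqnSn t) h) orbT.
case: b => //; rewrite nb_prod nb_bool => h; rewrite orFb infectionS; apply/orP; right.
rewrite -ltnS; apply: leq_trans h _.
apply: (@leq_trans (nb (infection r W t) u + 1)); last by rewrite addn1.
apply: leq_add; last exact: leq_b1.
by apply: nb_mono => w /IH.
Qed.

Lemma card_hamming d (u v : cube d) : #|[set i | u i != v i]| = hamming u v.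
Proof.
by rewrite -sum1dep_card /hamming [LHS]big_mkcond; apply: eq_bigr => i _; case: (_ != _).
Qed.

Lemma nb_cube d (A : {set cube d}) v : #|[set u in A | cube_adj v u]| = @nb (cubeH d) (mem A) v.
Proof.
rewrite nb_card -(card_imset [pred k | _] (@hflip_inj (cubeH d) v)).
apply: eq_card => u; rewrite !inE /cube_adj card_hamming; apply/andP/imsetP => [[uA /eqP]|[k]].
  by move=> /hamming1P[k kE]; exists k => //; rewrite inE /hflip /= -kE.
by rewrite !inE => kA ->; rewrite hamming_cflip_id.
Qed.

Lemma infected_infection r d (W : pred (cube d)) t v :
  (v \in infected r [set x | W x] t) = @infection (cubeH d) r W t v.
Proof.
elim: t v => [|t IH] v; first by rewrite /infected /= inE.
rewrite infectionS -IH /infected iterS -/(infected r [set x | W x] t) !inE.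
by rewrite nb_cube; congr (_ || (_ <= _)); apply: eq_bigr => k _; rewrite -IH.
Qed.

Lemma nb_hinv (T : hcube) (W : pred T) (v : cube (hdim T)) :
  @nb (cubeH (hdim T)) (fun x => W (hinv x)) v = nb W (hinv v).
Proof. by apply: eq_bigr => k _; rewrite /hflip hinvK. Qed.

Lemma infection_hinv (T : hcube) r (W : pred T) t (v : cube (hdim T)) :
  @infection (cubeH (hdim T)) r (fun x => W (hinv x)) t v = infection r W t (hinv v).
Proof.
elim: t v => // t IH v; rewrite !infectionS IH.
by rewrite -nb_hinv; congr (_ || (_ <= _)); apply: eq_bigr => k _; rewrite -IH.
Qed.

Lemma slow_percolation_max (T : hcube) r L :
  slow_percolation T r L -> L < max_perc_time r (hdim T).
Proof.
move=> [W hW [v hv]].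
pose A0 := [set x : cube (hdim T) | W (hinv x)].
have infE t x : (x \in infected r A0 t) = infection r W t (hinv x).
  by rewrite (infected_infection r (fun x => W (hinv x))) infection_hinv.
have [t ct] := infection_stable r W.
have hp : percolates r A0.
  exists t; apply/eqP/setP => x; rewrite infE inE.
  by apply: (hW (infection r W t)) => // u; exact: (@infection_mono _ r W 0 t).
apply: leq_trans (leq_bigmax_cond _ _); last exact/asboolP/hp.
rewrite /perc_time; case: pselect => // h; case: ex_minnP => k /eqP kE _.
rewrite ltnNge; apply: contra hv => kL; apply: infection_mono kL _.
by rewrite -(hisoK v) -infE kE inE.
Qed.

(** * From snakes to slow percolation *)

Definition upto (T : hcube) (s : seq T) (n : nat) : pred T :=
  fun v => `[< exists i, [/\ i < n, i < size s & s~[i] = v] >].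

Lemma upto_nth (T : hcube) (s : seq T) n i : i < n -> i < size s -> upto s n s~[i].
Proof. by move=> h1 h2; apply/asboolP; exists i. Qed.

Lemma uptoW (T : hcube) (s : seq T) n v : upto s n v -> upto s (size s) v.
Proof. by move/asboolP => [i [_ h <-]]; exact: upto_nth. Qed.

(* Neighbours of [v] on the snake are pairwise at distance 2, hence two steps  *)
(* apart along the snake.                                                      *)
Lemma snake_nb (T : hcube) (s : seq T) n v : snake 3 s -> nb (upto s n) v <= 2.
Proof.
move=> [sa sf]; rewrite leqNgt nb_card; apply/negP => /card_gt2P[k1 [k2 [k3 [[]]]]].
rewrite !inE => /asboolP[i [_ hi iE]] /asboolP[j [_ hj jE]] /asboolP[l [_ hl lE]] [n12 n23 n31].
have apart i' j' k k' : i' < size s -> j' < size s -> s~[i'] = hflip k v -> s~[j'] = hflip k' v ->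
    k != k' -> i' <= j' -> j' = i'.+2.
  move=> hi' hj' iE' jE' kk' ij.
  have le2 : dist s~[i'] s~[j'] <= 2.
    by rewrite iE' jE'; apply: leq_trans (dist_triangle v _ _) _; rewrite distC !dist_hflip.
  have ev : odd (dist s~[i'] s~[j']) = false.
    by rewrite (dist_odd v) iE' jE' distC !dist_hflip.
  have nij : i' != j'.
    by apply: contra_neq kk' => E; apply: (@hflip_inj _ v); rewrite -iE' -jE' E.
  have lij : i' < j' by rewrite ltn_neqAle nij.
  have := sf _ _ lij hj'; case: (eqVneq j' i'.+1) => [E|]; last by lia.
  by move: ev; rewrite E sa // -E.
have ap i' j' k k' : i' < size s -> j' < size s -> s~[i'] = hflip k v -> s~[j'] = hflip k' v ->
    k != k' -> j' = i'.+2 \/ i' = j'.+2.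
  move=> h1 h2 h3 h4 kk'; case: (leqP i' j') => ij; [left|right].
    exact: apart h1 h2 h3 h4 kk' ij.
  by apply: apart h2 h1 h4 h3 _ (ltnW ij); rewrite eq_sym.
have := ap _ _ _ _ hi hj iE jE n12; have := ap _ _ _ _ hj hl jE lE n23.
have := ap _ _ _ _ hl hi lE iE n31; lia.
Qed.

(* Two extra coordinates hold two infected copies of the snake, which lower    *)
(* the threshold on the snake to 1.                                            *)
Lemma slow_infection_snake (T : hcube) (s : seq T) : snake 3 s -> 1 < size s ->
  slow_infection (prodH (prodH T boolH) boolH) 3 (size s).-2.
Proof.
move=> hs s1; set S := prodH _ boolH; have [sa sf] := hs.
pose B t : pred S := fun p => let: (v, y1, y2) := p in
  if y1 (+) y2 then upto s (size s) v else ~~ y1 && upto s t.+1 v.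
exists (B 0), (s~[(size s).-1], false, false); split.
  suff sub : forall t v, t <= (size s).-2 -> infection 3 (B 0) t v -> B t v.
    apply/negP => /(sub _ _ (leqnn _)) /= /asboolP[i [h1 h2 E]].
    by have := sf i (size s).-1; rewrite E distxx; lia.
  apply: infection_sub => // t [[v y1] y2] _.
    by case: y1 y2 => [] [] //= /asboolP[i [h1 h2 <-]]; apply: upto_nth => //; lia.
  rewrite !nb_prod !nb_bool.
  case: y1; case: y2 => /=.
  - rewrite nb_pred0 //; by case: (upto _ _ _).
  - case: (boolP (upto s (size s) v)) => // nv.
    have hb : nb [eta upto s (size s)] v <= 2 := snake_nb (size s) v hs.
    have -> : upto s t.+1 v = false by apply: contraNF nv; exact: uptoW.
    by lia.
  - case: (boolP (upto s (size s) v)) => // nv.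
    have hb : nb [eta upto s (size s)] v <= 2 := snake_nb (size s) v hs.
    have -> : upto s t.+1 v = false by apply: contraNF nv; exact: uptoW.
    by lia.
  case: (boolP (upto s (size s) v)) => [/asboolP[j [_ hj <-]]|nv]; last first.
    have hb : nb [eta upto s t.+1] v <= 2 := snake_nb t.+1 v hs.
    by lia.
  case: (leqP j t.+1) => [jt _|jt]; first exact: upto_nth.
  move=> h; have /nb_gt0P[u /asboolP[i [h1 h2 <-]]] : 0 < nb [eta upto s t.+1] s~[j] by lia.
  by have := sf i j; rewrite distC; lia.
move=> Y cY BY.
have H i : i < size s -> Y (s~[i], false, false).
  elim: i => [|i IH] hi; first by apply: BY => /=; apply: upto_nth.
  apply: cY; rewrite !nb_prod !nb_bool !BY ?addn1; try exact: upto_nth.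
  rewrite !ltnS; apply: (@nb_gt0 _ _ _ s~[i]); first by apply: IH; lia.
  by rewrite distC; apply: sa.
by apply: H; lia.
Qed.

Section Hull.
Variables (T : hcube) (W : pred T) (o : T).
Hypothesis cW : closed_under 2 W.

Definition subcube_in (D : {set 'I_(hdim T)}) : Prop :=
  forall v, (forall k, k \notin D -> hiso v k = hiso o k) -> W v.

Lemma hiso_hflip k (v : T) i : hiso (hflip k v) i = (i == k) (+) hiso v i.
Proof. by rewrite hinvK ffunE. Qed.

Lemma subcube_in_grow D i u : subcube_in D -> W u -> hiso u i != hiso o i ->
  (forall k, k \notin D -> k != i -> hiso u k = hiso o k) -> subcube_in (i |: D).
Proof.
move=> hD Wu ui uo v hv.
case: (eqVneq (hiso v i) (hiso o i)) => [vi|vi].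
  apply: hD => k kD; case: (eqVneq k i) => [->//|ki].
  by apply: hv; rewrite !inE negb_or ki.
have [n] := ubnP (dist v u); elim: n v hv vi => // n IH v hv vi vn.
case: (eqVneq (hiso v) (hiso u)) => [/hiso_inj-> //|/hamming_neq[k vk dk]].
have ki : k != i.
  apply: contraNneq vk => ->; move: vi ui.
  by case: (hiso v i); case: (hiso o i); case: (hiso u i).
have kD : k \in D.
  apply: contraNT vk => kD; rewrite hv ?uo //.
  by rewrite !inE negb_or ki.
apply: cW; apply: (@nb_gt1 _ _ _ (hflip k v) (hflip i v)); rewrite ?dist_hflip //.
- apply: IH => [l lD||].
  + rewrite hiso_hflip hv //; case: eqP => // lk; move: lD.
    by rewrite lk !inE kD orbT.
  + by rewrite hiso_hflip (eq_sym i k) (negbTE ki).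
  + by move: vn; rewrite /dist hinvK; rewrite dk.
- apply: hD => l lD; rewrite hiso_hflip; case: eqP => [->|/eqP li].
    by move: vi; case: (hiso v i); case: (hiso o i).
  by apply: hv; rewrite !inE negb_or li.
- by move/hflip_inj => E; rewrite E eqxx in ki.
Qed.

Lemma hull_exists : W o -> exists2 D, subcube_in D &
  forall u, W u -> \sum_k ((k \notin D) && (hiso u k != hiso o k)) <= 2 ->
    forall k, hiso u k != hiso o k -> k \in D.
Proof.
move=> Wo.
have P0 : `[< subcube_in set0 >].
  apply/asboolP => v hv; have -> // : v = o.
  by apply: hiso_inj; apply/ffunP => k; apply: hv; rewrite inE.
case: (@arg_maxnP _ set0 (fun D => `[< subcube_in D >]) (fun D : {set 'I_(hdim T)} => #|D|) P0) => D /asboolP hD mD.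
have max i : i \notin D -> ~ subcube_in (i |: D).
  by move=> iD /asboolP/mD; rewrite /= cardsU1 iD add1n ltnn.
exists D => // u Wu hc k uk; apply: contraT => kD; exfalso.
case: (pselect (exists j, [/\ j != k, j \notin D & hiso u j != hiso o j])) => [[j [jk jD uj]]|none];
  last first.
  apply: (max k) => //; apply: (@subcube_in_grow _ _ u) => // l lD lk.
  by apply/eqP/negPn/negP => ul; apply: none; exists l.
have only l : l \notin D -> l != k -> l != j -> hiso u l = hiso o l.
  move=> lD lk lj; apply/eqP/negPn/negP => ul; move: hc; rewrite leqNgt => /negP; apply.
  by rewrite (bigD1 k) //= (bigD1 j) //= (bigD1 l) ?lk //= kD uk jD uj lD ul.
apply: (max k) => //; apply: (@subcube_in_grow _ _ (hflip j u)) => //.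
- apply: cW; apply: (@nb_gt1 _ _ _ u (hflip k (hflip j u))); rewrite ?dist_hflip //.
  + apply: hD => l lD; rewrite !hiso_hflip.
    case: (eqVneq l k) => [->|lk]; first by rewrite (eq_sym k j) (negbTE jk); move: uk; case: (hiso u k); case: (hiso o k).
    case: (eqVneq l j) => [->|lj]; first by move: uj; case: (hiso u j); case: (hiso o j).
    exact: only.
  + move=> /(congr1 (fun x => hiso x k)); rewrite !hiso_hflip eqxx (eq_sym k j) (negbTE jk).
    by case: (hiso u k).
  + by rewrite distC dist_hflip.
- by rewrite hiso_hflip (eq_sym k j) (negbTE jk).
move=> l lD lk; rewrite hiso_hflip; case: (eqVneq l j) => [->|lj]; last exact: only.
by move: uj; case: (hiso u j); case: (hiso o j).
Qed.

End Hull.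

Definition quad (b0 b1 b2 b3 : bool) : cube 4 := [ffun l : 'I_4 => nth false [:: b0; b1; b2; b3] l].

Lemma hamming_quad a0 a1 a2 a3 b0 b1 b2 b3 :
  hamming (quad a0 a1 a2 a3) (quad b0 b1 b2 b3) =
  (a0 != b0) + (a1 != b1) + (a2 != b2) + (a3 != b3).
Proof. by rewrite /hamming !big_ord_recl big_ord0 !ffunE /= addn0 !addnA. Qed.

Definition quad0 := quad false false false false.

Definition seed_label (i : nat) : cube 4 :=
  if i %% 3 is n.+1 then
    if n is _.+1 then quad true true false false else quad false true false true
  else quad false true true false.

Lemma seed_label_dist i j : i %% 3 != j %% 3 -> hamming (seed_label i) (seed_label j) = 2.
Proof.
rewrite /seed_label; have := ltn_pmod i (isT : 0 < 3); have := ltn_pmod j (isT : 0 < 3).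
by case: (i %% 3) => [|[|[|n]]]; case: (j %% 3) => [|[|[|n']]] // _ _ _; rewrite hamming_quad.
Qed.

Lemma seed_label_quad0 i : hamming quad0 (seed_label i) = 2.
Proof.
rewrite /seed_label; have := ltn_pmod i (isT : 0 < 3).
by case: (i %% 3) => [|[|[|n]]] // _; rewrite hamming_quad.
Qed.

Lemma seed_label_trigger i : 3 <= i + hamming (quad true false false false) (seed_label i).
Proof.
rewrite /seed_label; have := ltn_pmod i (isT : 0 < 3); have := leq_mod i 3.
by case: (i %% 3) => [|[|[|n]]] // h _; rewrite hamming_quad /=; lia.
Qed.

Lemma sum_ord_eq_le1 n k : \sum_(l < n) (val l == k) <= 1.
Proof.
case: (ltnP k n) => hk; last first.
  by rewrite big1 // => l _; apply/eqP; rewrite eqb0; apply: contraTneq (ltn_ord l) => ->; rewrite -leqNgt.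
rewrite (bigD1 (Ordinal hk)) //= eqxx big1 // => l.
by rewrite -val_eqE /= => /negbTE ->.
Qed.

Section Completion.
Variables (T : hcube) (o : T).

Definition prefix_flip (i : nat) : T :=
  hinv [ffun k : 'I_(hdim T) => (k < i) (+) hiso o k].

Lemma prefix_flip0 : prefix_flip 0 = o.
Proof. by rewrite -[RHS]hisoK; congr hinv; apply/ffunP => k; rewrite ffunE. Qed.

Lemma prefix_flip_dist i j : i <= j -> j <= hdim T -> j - i <= dist (prefix_flip i) (prefix_flip j).
Proof.
have S k : dist (prefix_flip k) (prefix_flip k.+1) <= 1.
  rewrite /dist !hinvK /hamming.
  apply: (@leq_trans (\sum_(l < hdim T) (val l == k))).
    apply: leq_sum => l _; rewrite !ffunE ltnS leq_eqVlt.
    by case: (hiso o l); case: (ltngtP l k).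
  exact: sum_ord_eq_le1.
have Sn k n : dist (prefix_flip k) (prefix_flip (k + n)) <= n.
  elim: n => [|n IH]; first by rewrite addn0 distxx.
  rewrite addnS; apply: leq_trans (dist_triangle (prefix_flip (k + n)) _ _) _.
  by have := S (k + n); lia.
move=> ij jm.
have full : dist (prefix_flip 0) (prefix_flip (hdim T)) = hdim T.
  rewrite /dist !hinvK /hamming -[RHS](card_ord (hdim T)) -sum1_card; apply: eq_bigr => l _.
  by rewrite !ffunE ltn_ord; case: (hiso o l).
have := dist_triangle (prefix_flip i) (prefix_flip 0) (prefix_flip (hdim T)).
have := dist_triangle (prefix_flip j) (prefix_flip i) (prefix_flip (hdim T)).
have := Sn 0 i; have := Sn j (hdim T - j); rewrite full add0n subnKC //; lia.
Qed.

Let Y := prodH T (cubeH 4).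

Definition seeds : pred Y :=
  fun y => `[< exists2 i, i <= hdim T & y = (prefix_flip i, seed_label i) >].

Definition trigger : Y := (o, quad true false false false).

Definition seeds_trigger : pred Y := fun y => seeds y || `[< y = trigger >].

Lemma seeds_weight v h : seeds (v, h) -> 2 <= hamming quad0 h.
Proof. by move=> /asboolP[i _ [_ ->]]; rewrite seed_label_quad0. Qed.

Lemma seeds_code u u' : seeds u -> seeds u' -> u <> u' -> 3 <= dist u u'.
Proof.
move=> /asboolP[i hi ->] /asboolP[j hj ->].
wlog ij : i j hi hj / i <= j.
  by move=> H; case: (leqP i j) => ij; [exact: H | move=> h; rewrite distC; apply: H (ltnW ij) _ => //; exact/nesym].
move=> nij; rewrite dist_prod dist_cube; have := prefix_flip_dist ij hj.
have {nij ij}ij : i < j.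
  by rewrite ltn_neqAle ij andbT; apply/eqP => E; apply: nij; rewrite E.
case: (ltnP 2 (j - i)) => d3; first by lia.
rewrite seed_label_dist; first by lia.
by apply/eqP; lia.
Qed.

Lemma trigger_code u : seeds u -> 3 <= dist trigger u.
Proof.
move=> /asboolP[i hi ->]; rewrite dist_prod dist_cube.
by have := seed_label_trigger i; have := prefix_flip_dist (leq0n i) hi; rewrite prefix_flip0 subn0; lia.
Qed.

Lemma seeds_trigger_code u u' : seeds_trigger u -> seeds_trigger u' -> u <> u' -> 3 <= dist u u'.
Proof.
move=> /orP[h|/asboolP->] /orP[h'|/asboolP->] // uu'; last exact: trigger_code.
  exact: seeds_code.
by rewrite distC; exact: trigger_code.
Qed.

Lemma seeds_percolate (W : pred Y) : 2 <= hdim T -> closed_under 2 W -> W (o, quad0) ->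
  (forall y, seeds y -> W y) -> forall y, W y.
Proof.
move=> T2 cW Wo WS.
have [D hD mD] := hull_exists cW Wo.
pose dl (j : 'I_(hdim T)) : 'I_(hdim Y) := lshift 4 j.
pose dr (l : 'I_4) : 'I_(hdim Y) := rshift (hdim T) l.
have seedP i : i <= hdim T ->
   \sum_(j < hdim T) ((dl j \notin D) && (j < i)) +
   \sum_(l < 4) ((dr l \notin D) && seed_label i l) <= 2 ->
   (forall j : 'I_(hdim T), j < i -> dl j \in D) /\ (forall l, seed_label i l -> dr l \in D).
  move=> hi hc; pose u : Y := (prefix_flip i, seed_label i).
  have ul j : (hiso u (dl j) != hiso (o, quad0) (dl j)) = (j < i).
    have -> : hiso u (dl j) = hiso (prefix_flip i) j := @prod_iso_lshift T (cubeH 4) u j.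
    have -> : hiso ((o, quad0) : Y) (dl j) = hiso o j :=
      @prod_iso_lshift T (cubeH 4) (o, quad0) j.
    rewrite hinvK ffunE.
    by case: (j < i); case: (hiso o j).
  have ur l : (hiso u (dr l) != hiso (o, quad0) (dr l)) = seed_label i l.
    have -> : hiso u (dr l) = seed_label i l := @prod_iso_rshift T (cubeH 4) u l.
    have -> : hiso ((o, quad0) : Y) (dr l) = quad0 l :=
      @prod_iso_rshift T (cubeH 4) (o, quad0) l.
    rewrite [X in _ != X]ffunE.
    by case: l => [[|[|[|[|l]]]]] //= ?; case: (seed_label i _).
  have /mD H : W u by apply: WS; apply/asboolP; exists i.
  have {}H := H _; split=> [j hj|l hl]; apply: H; rewrite ?ul ?ur //.
    rewrite /= big_split_ord /=; apply: leq_trans hc; apply: leq_add; apply: leq_sum => k _.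
      by rewrite -ul.
    by rewrite -ur.
  rewrite /= big_split_ord /=; apply: leq_trans hc; apply: leq_add; apply: leq_sum => k _.
    by rewrite -ul.
  by rewrite -ur.
have s0 (D' : pred 'I_4) : \sum_(l < 4) (D' l && seed_label 0 l) <= 2.
  apply: (@leq_trans (\sum_(l < 4) (seed_label 0 l : nat))).
    by apply: leq_sum => l _; case: (D' l).
  by rewrite !big_ord_recl big_ord0 !ffunE.
have [//||_ r0] := seedP 0.
  by rewrite big1 ?add0n ?s0 // => j _; rewrite ltn0 andbF.
have r1 : dr (@Ordinal 4 1 isT) \in D by apply: r0; rewrite ffunE.
have r2 : dr (@Ordinal 4 2 isT) \in D by apply: r0; rewrite ffunE.
have Hr i : \sum_(l < 4) ((dr l \notin D) && seed_label i l) <= 1.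
  rewrite !big_ord_recl big_ord0.
  have -> : lift ord0 (ord0 : 'I_3) = @Ordinal 4 1 isT :> 'I_4 by apply: val_inj.
  have -> : lift ord0 (lift ord0 (ord0 : 'I_2)) = @Ordinal 4 2 isT :> 'I_4 by apply: val_inj.
  rewrite r1 r2 /seed_label; have := ltn_pmod i (isT : 0 < 3).
  by case: (i %% 3) => [|[|[|n]]] // _; rewrite !ffunE /=; case: (_ \notin _) => //=; case: (_ \notin _).
have Hl i : (forall j : 'I_(hdim T), j < i -> dl j \in D) ->
    \sum_(j < hdim T) ((dl j \notin D) && (j < i.+1)) <= 1.
  move=> hi; apply: (@leq_trans (\sum_(j < hdim T) (val j == i))).
    apply: leq_sum => j _; case: (ltngtP j i) => ji.
    - by rewrite hi.
    - by rewrite [j < i.+1]ltnNge ji andbF.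
    - by case: (_ && _).
  exact: sum_ord_eq_le1.
have all_l i : i <= hdim T -> forall j : 'I_(hdim T), j < i -> dl j \in D.
  elim: i => // i IH hi; have [//||//] := seedP i.+1.
  by apply: (leq_add (Hl i (IH (ltnW hi))) (Hr _)).
have all_r i : i < hdim T -> forall l, seed_label i.+1 l -> dr l \in D.
  move=> hi; have [//||//] := seedP i.+1.
  by apply: (leq_add (Hl i (all_l i (ltnW hi))) (Hr _)).
move=> y; apply: hD => k; rewrite -(splitK k); case: (split k) => l /= /negP[].
  exact: (all_l (hdim T)).
have -> : rshift (hdim T) l = dr l by [].
case: l => [[|[|[|[|l]]]]] // hl.
- by apply: (all_r 1) => //; rewrite ffunE.
- by have -> : Ordinal hl = @Ordinal 4 1 isT by apply: val_inj.
- by have -> : Ordinal hl = @Ordinal 4 2 isT by apply: val_inj.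
- by apply: (all_r 0) => //; rewrite ?ffunE //; exact: ltnW.
Qed.

End Completion.

(* The last two coordinates give four layers. Layer (0,0) is infected, so that *)
(* layer (1,0) has threshold 2: it holds inert seeds which percolate as soon   *)
(* as [x] is infected in layer (1,1), where the given infection runs. Once     *)
(* layer (1,0) is full, the seeds percolate in layer (1,1), then in (0,1).     *)
Lemma slow_percolation_complete (T : hcube) L : 2 <= hdim T -> slow_infection T 3 L ->
  slow_percolation (prodH (prodH (prodH T (cubeH 4)) boolH) boolH) 3 L.
Proof.
move=> T2 [X [x [xL xY]]].
set S := prodH _ boolH.
pose Xt t := infection 3 X t.
pose K t : pred (prodH T (cubeH 4)) := fun y => (Xt t y.1 && (y.2 == quad0)) || seeds x y.
pose B t : pred S := fun p => let: (y, z1, z2) := p in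
  if z1 then (if z2 then K t y else seeds_trigger x y) else (if z2 then seeds x y else true).
have noseed v u : seeds x u -> @dist (prodH T (cubeH 4)) (v, quad0) u = 1 -> False.
  by case: u => w h /seeds_weight; rewrite dist_prod dist_cube; lia.
have nbs y : nb (seeds x) y <= 1 by apply: nb_code; exact: seeds_code.
have nbst y : nb (seeds_trigger x) y <= 1 by apply: nb_code; exact: seeds_trigger_code.
have seed_st y : seeds x y -> seeds_trigger x y by rewrite /seeds_trigger => ->.
exists (B 0); last first.
  exists ((x, quad0), true, true).
  have sub : forall t v, t <= L -> infection 3 (B 0) t v -> B t v.
    apply: infection_sub => // t [[y z1] z2] tL.
      case: z1; case: z2 => //= /orP[/andP[h1 h2]|h]; rewrite /K ?h ?orbT //.
      by apply/orP; left; rewrite h2 andbT; exact: infection_mono (leqnSn t) h1.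
    rewrite !nb_prod !nb_bool; case: y => v h.
    case: z1; case: z2 => //=.
    - case: (boolP (seeds x (v, h))) => [hs _|ns]; first by rewrite /K hs orbT.
      have hK : nb [eta K t] (v, h) <= nb (fun y : (prodH T (cubeH 4)) => Xt t y.1 && (y.2 == quad0)) (v, h) + nb (seeds x) (v, h).
        exact: nbU.
      have nE : nb (fun y : (prodH T (cubeH 4)) => Xt t y.1 && (y.2 == quad0)) (v, h) =
        nb (fun a' => Xt t a' && (h == quad0)) v + nb (fun b' : cubeH 4 => Xt t v && (b' == quad0)) h.
        exact: nb_prod.
      rewrite {}nE in hK.
      case: (eqVneq h quad0) => [hE|hn].
        subst h.
        have st0 : seeds_trigger x (v, quad0) = false.
          apply/negP => /orP[|/asboolP[_]]; first exact/negP.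
          by move=> /(congr1 (hamming quad0)); rewrite !hamming_quad.
        have s0 : nb (seeds x) (v, quad0) = 0.
          apply/eqP; rewrite -leqn0 leqNgt; apply/negP => /nb_gt0P[u hu]; exact: noseed.
        have h0 : nb (fun b' : cubeH 4 => Xt t v && (b' == quad0)) quad0 = 0.
          apply/eqP; rewrite -leqn0 leqNgt; apply/negP => /nb_gt0P[u /andP[_ /eqP->]].
          by rewrite distxx.
        have t0 : nb (fun a' => Xt t a' && (quad0 == quad0)) v <= nb (Xt t) v.
          by apply: nb_mono => u /andP[].
        rewrite st0 => h; apply/orP; left; rewrite eqxx andbT /Xt infectionS; apply/orP; right.
        by rewrite s0 h0 !addn0 in hK; rewrite !addn0 in h; exact: leq_trans h (leq_trans hK t0).
      have t0 : nb (fun a' => Xt t a' && (h == quad0)) v = 0.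
        by apply: nb_pred0 => u; rewrite (negbTE hn) andbF.
      have h0 : nb (fun b' : cubeH 4 => Xt t v && (b' == quad0)) h <= 1.
        by apply: nb_code => u u' /andP[_ /eqP->] /andP[_ /eqP->].
      move=> h3; exfalso; have hs : nb (seeds x) (v, h) <= 1 := nbs _.
      have kb : nb [eta K t] (v, h) <= 1 + nb (seeds x) (v, h).
        by apply: leq_trans hK _; rewrite t0 leq_add2r.
      have {}h3 : 2 < 1 + nb (seeds x) (v, h) + seeds_trigger x (v, h).
        by apply: leq_trans h3 _; rewrite addn0 leq_add2r.
      have st1 : seeds_trigger x (v, h) by move: h3; case: seeds_trigger => //; lia.
      have tE : (v, h) = trigger x.
        by case/orP: st1 => [|/asboolP//]; rewrite (negbTE ns).
      have /nb_gt0P[u hu] : 0 < nb (seeds x) (v, h).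
        by rewrite st1 in h3; lia.
      by rewrite tE; have := trigger_code hu; lia.
    - move=> h3; have {}h3 : 2 < nb (seeds_trigger x) (v, h) + 1 + K t (v, h) := h3.
      have hs : nb (seeds_trigger x) (v, h) <= 1 := nbst _.
      case: (boolP (K t (v, h))) h3 => [|_] h3; last first.
        by exfalso; lia.
      case/orP: h3 => [/andP[Xv /eqP hE]|/seed_st //] h3; exfalso; simpl in Xv, hE.
      have /nb_gt0P[u /orP[hu|/asboolP ->]] : 0 < nb (seeds_trigger x) (v, h).
        by lia.
        by rewrite hE; exact: noseed.
      rewrite hE dist_prod dist_cube hamming_quad /= => vx.
      have vE : v = x by apply: dist_eq0; lia.
      by move: xL; rewrite -vE (infection_mono (ltnW tL) Xv).
    move=> h3; have {}h3 : 2 < nb (seeds x) (v, h) + K t (v, h) + 1 := h3.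
    have hs : nb (seeds x) (v, h) <= 1 := nbs _.
    case: (boolP (K t (v, h))) h3 => [|_] h3; last first.
      by exfalso; lia.
    case/orP: h3 => [/andP[Xv /eqP hE]|//] h3; exfalso; simpl in Xv, hE.
    have /nb_gt0P[u hu] : 0 < nb (seeds x) (v, h).
      by lia.
    by rewrite hE; exact: noseed.
  by apply: contra xL => /(sub _ _ (leqnn _)) /= /orP[/andP[]//|/seeds_weight]; rewrite hamming_quad.
move=> Z cZ BZ.
have F y : Z (y, false, false) by apply: BZ.
have Kx : Z ((x, quad0), true, true).
  apply: (xY (fun v => Z ((v, quad0), true, true))) => [v hv|v Xv].
    apply: cZ; rewrite !nb_prod; apply: leq_trans hv _.
    by rewrite -!addnA leq_addr.
  by apply: BZ; rewrite /B /K /= /Xt /= Xv eqxx.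
have L1x : Z ((x, quad0), true, false).
  apply: cZ; rewrite nb_prod nb_prod !nb_bool /= F Kx !addn1 !ltnS.
  apply: (@nb_gt0 _ _ _ (trigger x)).
    by apply: BZ; rewrite /B /seeds_trigger; apply/orP; right; exact/asboolP.
  by rewrite dist_prod distxx dist_cube hamming_quad.
have L1 y : Z (y, true, false).
  move: y; apply: (@seeds_percolate T x (fun y => Z (y, true, false))) => //.
    move=> y hy; apply: cZ; rewrite nb_prod nb_prod !nb_bool F.
    by apply: leq_trans (leq_add hy (leqnn 1)) _; exact: leq_addr.
  by move=> y /seed_st hy; apply: BZ.
have K1 y : Z (y, true, true).
  move: y; apply: (@seeds_percolate T x (fun y => Z (y, true, true))) => //.
    move=> y hy; apply: cZ; rewrite nb_prod nb_prod !nb_bool L1 addnAC.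
    by apply: leq_trans (leq_add hy (leqnn 1)) _; exact: leq_addr.
  by move=> y hy; apply: BZ; rewrite /B /K hy orbT.
have L2 y : Z (y, false, true).
  apply: (@closed_connected (prodH T (cubeH 4)) (fun y => Z (y, false, true)) (prefix_flip x 0, seed_label 0)).
    move=> u hu; apply: cZ; rewrite nb_prod nb_prod !nb_bool K1 F.
    exact: leq_add (leq_add hu (leqnn 1)) (leqnn 1).
  by apply: BZ; rewrite /B; apply/asboolP; exists 0.
by move=> [[y [|]] [|]].
Qed.

(** * Bounds on the percolation time *)

Lemma slow_percolation_addn (T : hcube) r L k : slow_percolation T r L ->
  exists2 T' : hcube, hdim T' = hdim T + k & slow_percolation T' (r + k) L.
Proof.
elim: k => [|k IH] h; first by exists T; rewrite !addn0.
have [T' dT' hT'] := IH h; exists (prodH T' boolH); first by rewrite /= dT' addn1 addnS.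
by rewrite addnS; exact: slow_percolationS.
Qed.

Lemma max_perc_time_snake r a s q q1 (b := s + (q + q + q)) :
  3 <= r -> a < 2 ^ s -> s < 2 ^ q -> b < 2 ^ q1 -> 3 < a ->
  2 ^ a * 2 ^ b <= 8 * max_perc_time r (a + 2 * (b + 2 * (3 * q1 + 3) + 3) + 8 + (r - 3)).
Proof.
move=> r3 h1 h2 h3 a3; have [|T [p [dT hp sp]]] := long_snake_exists h1 h2 h3; first by lia.
have p2 : 2 < size p.
  have h4 : 2 ^ 4 <= 2 ^ a * 2 ^ b.
    by apply: leq_trans (leq_pmulr _ _); rewrite ?expn_gt0 // leq_exp2l.
  by have := leq_trans h4 sp; lia.
have T2 : 2 <= hdim T + 1 + 1 by lia.
have H1 := slow_infection_snake hp (ltnW p2).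
have H2 := slow_percolation_complete (T2 : 2 <= hdim (prodH (prodH T boolH) boolH)) H1.
have [T' dT' H3] := slow_percolation_addn (r - 3) H2.
have := slow_percolation_max H3; rewrite dT' /= dT subnKC //.
have -> : a + 2 * (s + (q + q + q) + 2 * (3 * q1 + 3) + 3) + 1 + 1 + 4 + 1 + 1 + (r - 3) =
  a + 2 * (b + 2 * (3 * q1 + 3) + 3) + 8 + (r - 3) by rewrite /b; lia.
by move=> hM; apply: leq_trans sp _; lia.
Qed.

Lemma infected_mono r d (A : {set cube d}) t t' : t <= t' -> infected r A t \subset infected r A t'.
Proof.
move=> /subnK <-; elim: (t' - t) => // n IH.
by apply: subset_trans IH _; rewrite addSn /infected iterS; exact: subsetUl.
Qed.

Lemma infectedS r d (A : {set cube d}) t v :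
  (v \in infected r A t.+1) =
  (v \in infected r A t) || (r <= #|[set u in infected r A t | cube_adj v u]|).
Proof. by rewrite /infected iterS -/(infected r A t) !inE. Qed.

Lemma cube_adj_sym d : symmetric (@cube_adj d).
Proof. by move=> u v; rewrite /cube_adj !card_hamming hammingC. Qed.

Lemma cube_adj_degree d (v : cube d) : #|[set u | cube_adj v u]| = d.
Proof.
have -> : [set u | cube_adj v u] = [set u in [set: cube d] | cube_adj v u].
  by apply/setP => u; rewrite !inE.
rewrite nb_cube /nb (eq_bigr (fun=> 1)); first by rewrite sum1_card card_ord.
by move=> k _; rewrite /= inE.
Qed.

(* One vertex [v i], newly infected at time [i + 2], is chosen for each [i]; it *)
(* has fewer than [r] neighbours infected at time [i]. Conversely a vertex [w]  *)
(* is infected one step after [r] of the [v i] adjacent to it, so at most       *)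
(* [r + 2] of these are not preceded by [w].                                    *)
Lemma new_vertices_bound r d (A : {set cube d}) n (v : 'I_n -> cube d) : 0 < r ->
  (forall i : 'I_n, v i \in infected r A i.+2 :\: infected r A i.+1) ->
  n * d <= n * r.-1 + 2 ^ d * r.+2.
Proof.
move=> r0 hv.
have inj_v : injective v.
  have lt i j : v i = v j -> i < j -> False.
    move=> E ij; have := hv i; have := hv j; rewrite E !in_setD => /andP[/negP h _] /andP[_ h'].
    have le : i.+2 <= j.+1 by [].
    by apply: h; exact: (subsetP (infected_mono r A le)) h'.
  move=> i j E; apply/val_inj; case: (ltngtP (val i) (val j)) => // ij; exfalso.
    exact: lt E ij.
  exact: lt (esym E) ij.
have -> : n * d = \sum_(i < n) \sum_(w : cube d) (cube_adj (v i) w : nat).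
  have -> : n * d = \sum_(i < n) d by rewrite sum_nat_const card_ord.
  apply: eq_bigr => i _; rewrite -[LHS](cube_adj_degree (v i)) -sum1dep_card big_mkcond.
  by apply: eq_bigr => w _; case: cube_adj.
have -> : \sum_(i < n) \sum_(w : cube d) (cube_adj (v i) w : nat) =
  \sum_(i < n) \sum_(w : cube d) (cube_adj (v i) w && (w \in infected r A i)) +
  \sum_(w : cube d) \sum_(i < n) (cube_adj (v i) w && (w \notin infected r A i)).
  rewrite [X in _ + X]exchange_big -big_split; apply: eq_bigr => i _.
  rewrite -big_split; apply: eq_bigr => w _ /=.
  by case: cube_adj; case: (w \in _).
apply: leq_add.
  have -> : n * r.-1 = \sum_(i < n) r.-1 by rewrite sum_nat_const card_ord.
  apply: leq_sum => i _.
  have := hv i; rewrite in_setD => /andP[h _].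
  have : #|[set u in infected r A i | cube_adj (v i) u]| < r.
    by rewrite ltnNge; apply: contra h => h; rewrite infectedS h orbT.
  have -> : #|[set u in infected r A i | cube_adj (v i) u]| =
     \sum_(w : cube d) (cube_adj (v i) w && (w \in infected r A i)).
    rewrite -sum1dep_card big_mkcond; apply: eq_bigr => w _ /=.
    by case: cube_adj; case: (w \in _).
  by lia.
have -> : 2 ^ d = #|cube d| by rewrite card_ffun card_bool card_ord.
rewrite -sum_nat_const; apply: leq_sum => w _.
pose N := [set i : 'I_n | cube_adj (v i) w && (w \notin infected r A i)].
have -> : \sum_(i < n) (cube_adj (v i) w && (w \notin infected r A i)) = #|N|.
  rewrite -sum1dep_card [RHS]big_mkcond; apply: eq_bigr => i _.
  by case: (_ && _).
case: (set_0Vmem N) => [->|[i0 i0N]]; first by rewrite cards0.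
case: (@arg_maxnP _ i0 (mem N) val i0N) => m mN mmax.
pose N1 := [set i in N | i + 3 <= m].
have sub : N \subset N1 :|: [set i : 'I_n | m < i + 3 <= m + 3].
  apply/subsetP => i iN; rewrite !inE; have := mmax i iN; move: iN; rewrite inE => -> /=.
  by rewrite /geq /= => im; case: (leqP (i + 3) m) => //= _; rewrite leq_add2r.
have c2 : #|[set i : 'I_n | m < i + 3 <= m + 3]| <= 3.
  have := @card_in_imset _ _ (fun i : 'I_n => inord (m - i) : 'I_3)
    [set i : 'I_n | m < i + 3 <= m + 3].
  move=> <-; first by apply: leq_trans (max_card _) _; rewrite card_ord.
  move=> i j; rewrite !inE => hi hj /(congr1 val) /=.
  rewrite !inordK; [|lia|lia] => E; apply: val_inj => /=; lia.
have c1 : #|N1| < r.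
  rewrite ltnNge; apply/negP => hr; have : m \in N := mN; rewrite inE => /andP[_ /negP]; apply.
  case: (ltnP m 3) => m3.
    have N10 : N1 = set0 by apply/setP => i; rewrite in_set0 in_set; apply/negbTE/negP => /andP[_ h]; lia.
    by move: hr; rewrite N10 cards0; lia.
  rewrite -(ltn_predK m3).
  rewrite infectedS; apply/orP; right; apply: leq_trans hr _.
  rewrite -(card_imset _ inj_v); apply: subset_leq_card; apply/subsetP => u /imsetP[i].
  rewrite !inE => /andP[/andP[iw _] im] ->; rewrite cube_adj_sym iw andbT.
  have := hv i; rewrite in_setD => /andP[_]; apply/subsetP/infected_mono.
  by lia.
apply: leq_trans (subset_leq_card sub) _; apply: leq_trans (leq_card_setU _ _) _.
by lia.
Qed.

Lemma perc_time_upper r d (A : {set cube d}) : 0 < r ->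
  (perc_time r A).-1 * d <= (perc_time r A).-1 * r.-1 + 2 ^ d * r.+2.
Proof.
move=> r0; rewrite /perc_time; case: pselect => // h; case: ex_minnP => T /eqP TE Tmin.
have new t : t < T -> exists u, u \in infected r A t.+1 :\: infected r A t.
  move=> tT; apply/set0Pn; apply: contraTneq tT => E; rewrite -leqNgt; apply: Tmin.
  have fixp : infected r A t.+1 = infected r A t.
    apply/eqP; rewrite eqEsubset -setD_eq0 E eqxx andTb; exact: infected_mono (leqnSn t).
  have st k : infected r A (k + t) = infected r A t.
    elim: k => // k IH; rewrite addSn /infected iterS -/(infected r A (k + t)) IH.
    by rewrite -[RHS]fixp /infected iterS.
  have := infected_mono r A (leq_addr t T); rewrite st TE => s.
  by rewrite eqEsubset subsetT.
have /choice[v vE] : forall i : 'I_T.-1, exists u, u \in infected r A i.+2 :\: infected r A i.+1.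
  by move=> i; apply: new; have := ltn_ord i; lia.
exact: new_vertices_bound r0 vE.
Qed.

Lemma max_perc_time_upper r d : 0 < r -> r.*2 <= d ->
  max_perc_time r d * d <= (2 * r + 5) * 2 ^ d.
Proof.
move=> r0 rd; have d0 : 0 < d by lia.
rewrite -leq_divRL //; apply/bigmax_leqP => A _; rewrite leq_divRL //.
have := perc_time_upper A r0; have := ltn_expl d (isT : 1 < 2).
case: (perc_time r A) => [|T] /=; first by rewrite mul0n.
move: (2 ^ d) => N; nia.
Qed.

Lemma trunc_log2_bounds n : 0 < n ->
  [/\ 2 ^ (trunc_log 2 n).+1 <= 2 * n, n < 2 ^ (trunc_log 2 n).+1 & (trunc_log 2 n).+1 <= n].
Proof.
move=> n0; have /andP[h1 h2] := trunc_log_bounds (isT : 1 < 2) n0.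
by split=> //; [rewrite expnS leq_pmul2l | apply: leq_trans (ltn_expl _ _) h1].
Qed.

Lemma max_perc_time_lower r : 3 <= r -> exists K, forall d, 40 + r <= trunc_log 2 d ->
  2 ^ d <= max_perc_time r d * d * (K * (trunc_log 2 d).+1 ^ 15).
Proof.
move=> r3; pose c := 8 ^ 12; exists (128 * (c * 2 ^ (23 + r))) => d; set n := trunc_log 2 d => hn.
have d0 : 0 < d by rewrite lt0n; apply: contraTneq hn => d0; rewrite /n d0 trunc_log0.
have [hs1 hs2 _] := trunc_log2_bounds d0.
have /andP[hnd _] := trunc_log_bounds (isT : 1 < 2) d0.
rewrite -/n in hs1 hs2 hnd *; set s := n.+1 in hs1 hs2 *.
have [hq1 hq2 hq3] := trunc_log2_bounds (isT : 0 < s).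
set q := (trunc_log 2 s).+1 in hq1 hq2 hq3.
pose b := s + (q + q + q); have b0 : 0 < b by rewrite /b /s; lia.
have [hp1 hp2 hp3] := trunc_log2_bounds b0.
set q1 := (trunc_log 2 b).+1 in hp1 hp2 hp3.
have b4 : b <= 4 * s by rewrite /b; lia.
pose e := 2 * (b + 2 * (3 * q1 + 3) + 3) + 8 + (r - 3).
have ed : e + 4 <= d.
  apply: leq_trans hnd; have -> : n = 10 + (n - 10) by lia.
  rewrite expnD; apply: (@leq_trans (2 ^ 10 * (n - 9))); last first.
    by rewrite leq_pmul2l //; have := ltn_expl (n - 10) (isT : 1 < 2); lia.
  have -> : 2 ^ 10 = 1024 by [].
  by rewrite /e; move: b4 hp3; rewrite /s; lia.
have as' : d - e < 2 ^ s by apply: leq_ltn_trans hs2; exact: leq_subr.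
have a3 : 3 < d - e by lia.
have := max_perc_time_snake r3 as' hq2 hp2 a3; rewrite -/b.
have -> : d - e + 2 * (b + 2 * (3 * q1 + 3) + 3) + 8 + (r - 3) = d.
  by move: ed; rewrite /e; lia.
move=> hM.
have -> : 2 ^ d = (2 ^ (d - e) * 2 ^ b) * (2 ^ b * ((2 ^ q1) ^ 12 * 2 ^ (23 + r))).
  by rewrite -expnM -!expnD; congr (2 ^ _); move: ed; rewrite /e; lia.
have hb : 2 ^ b <= (2 * d) * (2 * s) ^ 3.
  have -> : 2 ^ b = 2 ^ s * (2 ^ q) ^ 3 by rewrite -expnM -expnD /b; congr (2 ^ _); lia.
  by apply: leq_mul => //; rewrite leq_exp2r.
have hq : (2 ^ q1) ^ 12 <= c * s ^ 12.
  by rewrite /c -expnMn leq_exp2r //; apply: leq_trans hp1 _; lia.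
apply: leq_trans (leq_mul hM (leq_mul hb (leq_mul hq (leqnn _)))) _.
have -> : s ^ 15 = s ^ 3 * s ^ 12 by rewrite -expnD.
move: {hM} (max_perc_time r d) => M; rewrite expnMn.
have -> : 2 ^ 3 = 8 by [].
move: c {hq} (2 ^ (23 + r)) (s ^ 3) (s ^ 12) => c' V s3 s12.
by apply: eq_leq; lia.
Qed.

Import Order.TTheory GRing.Theory Num.Theory.
Local Open Scope ring_scope.

Theorem theorem3p1 (R : realType) (r : nat) (hr : (3 <= r)%N) :
  exists2 C : R, 0 < C &
    exists d0 : nat, forall d : nat, (d0 <= d)%N ->
      2 ^+ d / (d%:R * ln d%:R `^ C) <= (max_perc_time r d)%:R
        <= 2 ^+ d / d%:R * ln d%:R `^ C.
Proof.
have [K hK] := max_perc_time_lower hr.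
exists 16%:R; first by rewrite ltr0n.
have ln2 : 0 < ln (2 : R) by rewrite ln_gt0 // ltr1n.
pose c : R := 1 + (ln 2)^-1.
have c0 : 0 <= c by rewrite addr_ge0 ?ler01 ?invr_ge0 ?ltW.
pose G : R := 1 + (2 * r + 5)%:R + K%:R * c ^+ 15.
have G1 : 1 + (2 * r + 5)%:R <= G by rewrite lerDl mulr_ge0 ?ler0n ?exprn_ge0.
have G2 : K%:R * c ^+ 15 <= G by rewrite lerDr addr_ge0 ?ler0n ?ler01.
have G0 : 1 <= G by apply: le_trans G1; rewrite lerDl ler0n.
exists (maxn (2 ^ (40 + r)) (Num.truncn (expR G)).+1) => d; rewrite geq_max => /andP[d1 d2].
have d0 : (0 < d)%N by apply: leq_trans d1; rewrite expn_gt0.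
have dR : 0 < d%:R :> R by rewrite ltr0n.
have hG : G <= ln d%:R.
  rewrite -(expRK G) ler_ln ?posrE ?expR_gt0 //.
  apply: ltW; apply: lt_le_trans (truncnS_gt _) _.
  by rewrite ler_nat.
set l := ln d%:R in hG *.
have l1 : 1 <= l := le_trans G0 hG.
have l0 : 0 <= l := le_trans ler01 l1.
rewrite powR_mulrn //.
have lp : 0 < l ^+ 16 by rewrite exprn_gt0 // (lt_le_trans ltr01).
apply/andP; split.
  rewrite (ler_pdivrMr _ _ (mulr_gt0 dR lp)).
  have n40 : (40 + r <= trunc_log 2 d)%N by rewrite trunc_log_max.
  have := hK d n40; rewrite -(ler_nat R) 3!natrM !natrX => h.
  apply: le_trans h _; rewrite -mulrA; apply: ler_wpM2l; first by rewrite ler0n.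
  apply: ler_wpM2l; first exact: ltW.
  have hs : (trunc_log 2 d).+1%:R <= c * l.
    rewrite -natr1 addrC mulrDl mul1r; apply: lerD => //.
    rewrite mulrC ler_pdivlMr // mulr_natl -lnXn ?ltr0n //.
    rewrite ler_ln ?posrE ?exprn_gt0 ?ltr0n //.
    by rewrite -natrX ler_nat; have /andP[] := trunc_log_bounds (isT : (1 < 2)%N) d0.
  apply: (@le_trans _ _ (K%:R * (c * l) ^+ 15)).
    apply: ler_wpM2l; first by rewrite ler0n.
    by apply: lerXn2r; rewrite ?nnegrE ?ler0n ?mulr_ge0.
  rewrite exprMn mulrA [l ^+ 16]exprS; apply: ler_wpM2r; first exact: exprn_ge0.
  exact: le_trans G2 hG.
rewrite mulrAC ler_pdivlMr //.
have r2d : (r.*2 <= d)%N.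
  apply: leq_trans d1; rewrite -mul2n; apply: (@leq_trans (2 ^ r.+1)).
    by rewrite expnS leq_pmul2l // ltnW // ltn_expl.
  by rewrite leq_exp2l //; lia.
have := max_perc_time_upper (ltnW (ltnW hr)) r2d; rewrite -(ler_nat R) !natrM natrX => h.
apply: le_trans h _; rewrite mulrC; apply: ler_wpM2l; first by rewrite exprn_ge0 ?ler0n.
apply: (@le_trans _ _ l).
  by apply: le_trans hG; apply: le_trans G1; rewrite ler_wpDl.
by apply: ler_eXnr.
Qed.
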